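(* Let $k\ge 1$, let $\mathbf a=(a_1,\dots,a_k)$ with $a_1>0$ and $a_i\ge 0$ for $2\le i\le k$, let $(X_i,T_i)$, $1\le i\le k$, be topological dynamical systems such that $(X_{i+1},T_{i+1})$ is a factor of $(X_i,T_i)$ for $1\le i\le k-1$, with factor maps $\tau_i:X_1\to X_{i+1}$ and $\tau_0=\mathrm{id}_{X_1}$, and let $f\in C(X_1,\mathbb R)$. Let $\alpha_i$ be a finite Borel partition of $X_i$ for $1\le i\le k$ and let $\mu$ be a $T_1$-invariant Borel probability measure on $X_1$. Then for any $\epsilon>0$ there exist open covers $\mathcal U_i$ of $X_i$, $1\le i\le k$, such that $|\mathcal U_i|=|\alpha_i|+1$ and $\tau_{i-1}\mu(\mathcal U_i\Delta\alpha_i)<\epsilon$ for $1\le i\le k$, and $$P^{\mathbf a}(T_1,\operatorname{supp}\mu,\{\mathcal U_i\}_{i=1}^k,f)\ \ge\ \sum_{i=1}^k a_i\,h_\mu\Big(T_1,\bigvee_{j=i}^k\tau_{j-1}^{-1}\alpha_j\Big)+\int f\,d\mu-\epsilon .$$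
   Context: A topological dynamical system $(X,T)$ is a compact metric space $X$ with a continuous map $T:X\to X$. $(Y,S)$ is a factor of $(X,T)$ if there is a continuous surjection $\pi:X\to Y$ with $\pi\circ T=S\circ\pi$ (a factor map). Given factor maps $\pi_i:X_i\to X_{i+1}$ ($1\le i\le k-1$), $\tau_i=\pi_i\circ\cdots\circ\pi_1:X_1\to X_{i+1}$ and $\tau_0=\mathrm{id}_{X_1}$. $\tau_{i-1}\mu$ is the push-forward of $\mu$ by $\tau_{i-1}$. $C(X_1,\mathbb R)$ is the set of real continuous functions on $X_1$. For covers, $\bigvee$ is the common refinement (all intersections), and for a cover (or partition) $\mathcal V$ of $X_1$, $\mathcal V_0^{n-1}=\bigvee_{l=0}^{n-1}T_1^{-l}\mathcal V$. $\lceil u\rceil$ is the least integer $\ge u$. $S_nf=\sum_{l=0}^{n-1}f\circ T_1^l$. Local weighted pressure. For $Z\subset X_1$, $N\in\mathbb N$, $s\in\mathbb R$ and open covers $\mathcal U_i$ of $X_i$, put $$\Lambda^{\mathbf a,s}_{N,\{\mathcal U_i\}}(Z,f)=\inf\sum_j \exp\Big(-sn_j+\tfrac1{a_1}\sup_{x\in A_j}S_{\lceil a_1n_j\rceil}f(x)\Big),$$ the infimum over all countable collections $\{(n_j,A_j)\}_j$ with $n_j\ge N$, $Z\subset\bigcup_jA_j$, and each $A_j$ a Borel subset of some element of $\bigvee_{i=1}^k(\tau_{i-1}^{-1}\mathcal U_i)_0^{\lceil(a_1+\dots+a_i)n_j\rceil-1}$. This is nondecreasing in $N$; let $\Lambda^{\mathbf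 a,s}_{\{\mathcal U_i\}}(Z,f)=\lim_{N\to\infty}\Lambda^{\mathbf a,s}_{N,\{\mathcal U_i\}}(Z,f)$ and $$P^{\mathbf a}(T_1,Z,\{\mathcal U_i\}_{i=1}^k,f)=\inf\{s:\Lambda^{\mathbf a,s}_{\{\mathcal U_i\}}(Z,f)=0\}=\sup\{s:\Lambda^{\mathbf a,s}_{\{\mathcal U_i\}}(Z,f)=+\infty\}.$$ $h_\mu(T_1,\alpha)$ is the usual Kolmogorov–Sinai entropy of $T_1$ with respect to the finite Borel partition $\alpha$. $\operatorname{supp}\mu$ is the topological support. Partitions and covers are regarded as indexed finite families; for $\alpha=\{A_1,\dots,A_m\}$ and $\mathcal U=\{U_0,U_1,\dots,U_m\}$, $\nu(\mathcal U\Delta\alpha)=\nu(U_0)+\sum_{l=1}^m\nu(U_l\Delta A_l)$ (i.e. $\alpha$ is padded with $A_0=\emptyset$, and the sum of measures of symmetric differences is taken). *)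

(* Defs.v *)
From HB Require Import structures.
From mathcomp Require Import all_boot all_order all_algebra.
From mathcomp Require Import all_classical all_reals all_analysis.
Set Implicit Arguments.
Unset Strict Implicit.
Unset Printing Implicit Defensive.
Import Order.TTheory GRing.Theory Num.Theory.
Import numFieldNormedType.Exports.
Local Open Scope classical_set_scope.
Local Open Scope ring_scope.

(* The point is only there because [measurableType] extends [pointedType]; a
   space that carries a probability measure is nonempty anyway. *)
#[short(type="pmetricType")]
HB.structure Definition PMetric (K : numDomainType) :=
  { M of Pointed M & Metric K M }.

Definition borel (X : ptopologicalType) := g_sigma_algebraType (@open X).

Definition tds (R : realType) (X : pmetricType R) (T : X -> X) : Prop :=
  compact [set: X] /\ continuous T.

Definition factor_map (R : realType) (X Y : pmetricType R)
    (T : X -> X) (S : Y -> Y) (p : X -> Y) : Prop :=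
  [/\ continuous p, range p = [set: Y] & forall x, p (T x) = S (p x)].

(* Indices start at 0: the spaces X_1, ..., X_k of the mathematical text are
   [X 0, ..., X k.-1], so that [tau p i : X 0 -> X i] is the map written
   tau_i : X_1 -> X_{i+1} there. *)
Fixpoint tau (X : nat -> Type) (p : forall i, X i -> X i.+1) (i : nat) :
    X 0%N -> X i :=
  match i with
  | 0 => fun x => x
  | j.+1 => fun x => p j (tau p j x)
  end.

Section Covers.
Context {T : Type}.

(* Joins are the set of all intersections; the join over the empty index set
   is the trivial cover [[set setT]]. *)
Definition join {I : Type} (D : set I) (V : I -> set (set T)) : set (set T) :=
  [set \bigcap_(i in D) B i | B in [set B | forall i, D i -> V i (B i)]].

Definition pullback {Y : Type} (g : T -> Y) (V : set (set Y)) : set (set T) :=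
  [set g @^-1` B | B in V].

(* V_0^{n-1} *)
Definition iter_join (S : T -> T) (V : set (set T)) (n : nat) : set (set T) :=
  join `I_n (fun l => pullback (iter l S) V).

Definition is_cover {m : nat} (U : 'I_m -> set T) : Prop :=
  \bigcup_i U i = [set: T].

End Covers.

Definition is_open_cover (X : topologicalType) (m : nat) (U : 'I_m -> set X) :
    Prop :=
  is_cover U /\ forall l, open (U l).

(* Partitions are indexed families, so empty cells are allowed. *)
Definition is_borel_partition (X : ptopologicalType) (m : nat)
    (A : 'I_m -> set X) : Prop :=
  [/\ is_cover A, trivIset [set: 'I_m] A &
      forall l, measurable (A l : set (borel X))].

(* nu (U Delta A), with A padded by the empty cell at index 0 *)
Definition cover_dist {R : realType} {X : Type} (nu : set X -> \bar R)
    (m : nat) (U : 'I_m.+1 -> set X) (A : 'I_m -> set X) : \bar R :=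
  (nu (U ord0) + \sum_(l < m) nu (U (lift ord0 l) `+` A l))%E.

Section Measures.
Context {R : realType} {X : ptopologicalType}.
Variable mu : probability (borel X) R.

Definition invariant_measure (T : X -> X) : Prop :=
  forall A : set (borel X), measurable A -> mu (T @^-1` A) = mu A.

Definition supp : set X :=
  [set x | forall O : set X, open O -> O x -> (0 < mu O)%E].

(* With [ln 0 = 0], null cells contribute 0, as in the convention 0 log 0 = 0. *)
Definition entropy (P : set (set X)) : R :=
  \sum_(A \in P) - (fine (mu A) * ln (fine (mu A))).

Definition ks_entropy (T : X -> X) (P : set (set X)) : R :=
  limn (fun n : nat => n%:R^-1 * entropy (iter_join T P n)).

End Measures.

(* Only used at nonnegative reals. *)
Definition nceil {R : realType} (x : R) : nat := `|Num.ceil x|%N.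

Definition birkhoff_sum {R : realType} {X : Type} (T : X -> X) (f : X -> R)
    (n : nat) (x : X) : R :=
  \sum_(l < n) f (iter l T x).

Section Pressure.
Context {R : realType}.
Variables (k : nat) (a : nat -> R) (X : nat -> pmetricType R).
Variables (T : X 0%N -> X 0%N) (p : forall i, X i -> X i.+1).
Variables (U : forall i, set (set (X i))) (f : X 0%N -> R) (Z : set (X 0%N)).

Definition weighted_join (n : nat) : set (set (X 0%N)) :=
  join `I_k (fun i => iter_join T (pullback (tau p i) (@U i))
                        (nceil ((\sum_(j < i.+1) a j) * n%:R))).

(* A countable collection is a family indexed by an arbitrary [J : set nat].
   An empty member has [ereal_sup set0 = -oo] and contributes [expeR -oo = 0]. *)
Definition Lambda_N (s : R) (N : nat) : \bar R :=
  ereal_inf [set r | exists (J : set nat) (n : nat -> nat)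
                            (A : nat -> set (X 0%N)),
    [/\ forall j, J j -> (N <= n j)%N,
        Z `<=` \bigcup_(j in J) A j,
        forall j, J j -> measurable (A j : set (borel (X 0%N))),
        forall j, J j -> exists2 B, weighted_join (n j) B & A j `<=` B &
        r = \esum_(j in J)
              expeR ((- s * (n j)%:R)%:E +
                     ((a 0%N)^-1)%:E *
                     ereal_sup [set (birkhoff_sum T f
                                       (nceil (a 0%N * (n j)%:R)) x)%:E
                               | x in A j])%E]].

Definition Lambda (s : R) : \bar R := limn (Lambda_N s).

Definition pressure : \bar R :=
  ereal_inf [set s%:E | s in [set s | Lambda s = 0%E]].

End Pressure.

(* Main.v *)
Require Import Defs.
From HB Require Import structures.
From mathcomp Require Import all_boot all_order all_algebra.
From mathcomp Require Import all_classical all_reals all_analysis.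
From mathcomp Require Import finmap measurable_realfun ring lra.
Import Order.TTheory GRing.Theory Num.Theory.
Import numFieldNormedType.Exports.
Local Open Scope classical_set_scope.
Local Open Scope ring_scope.

(* The lower bound for the pressure is a mass distribution argument: it suffices
   to find a set [G] of positive measure such that, for all large [n], every
   Borel subset [A] of an element of the [n]-th weighted join satisfies
   [mu (A `&` G) <= exp (- (H - eps) n + sup_A S f / a_1)].

   For one partition, let [i_K x] be the information of the cell of [x] given
   the cells of [T x, ..., T^K x]. Since the means of [i_K] decrease to the
   entropy and [exp (i_K - i_K')] has mean at most one for [K' <= K], the infimum
   [g] of [i_K] over a sparse set of [K]s has mean close to the entropy, and [g]
   depends on no horizon. As [exp i_K] is the inverse of a conditional
   probability, integrating the first time first shows that the integral of the
   product of [exp (g (T^l x))] over [l < L] and the points with a prescribed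
   name is at most one (this is the sandwich argument of Algoet and Cover, and
   replaces the Shannon-McMillan-Breiman theorem). This still holds when
   the partition at time [l] becomes coarser as [l] grows, as it does in the
   weighted joins.

   The cover elements are the complements of unions of closed sets inside the
   cells, so that an element of the join determines the name of a point except at
   the times spent in a set [V] of small measure; these are paid for by a penalty
   factor on the wrong letters, and are rare by the maximal ergodic theorem.
   Birkhoff's theorem for [g] and [f] yields [G]; no ergodicity is needed since
   only positive measure is asked for. *)

Set Implicit Arguments.
Unset Strict Implicit.
Unset Printing Implicit Defensive.

(** * Bounded measurable functions and the maximal ergodic theorem *)

Section BoundedMeasurable.
Context d (T : measurableType d) (R : realType) (mu : probability T R).
Implicit Types (f g : T -> R).

(** Boundedness makes these functions integrable against a probability, so that [mean] is linear and
    monotone without integrability conditions. *)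
Definition bdmeas f :=
  measurable_fun setT f /\ exists M : R, forall x, `|f x| <= M.

Lemma bdmeas_cst (c : R) : bdmeas (cst c).
Proof. by split=> //; exists `|c|. Qed.

Lemma bdmeasD f g : bdmeas f -> bdmeas g -> bdmeas (fun x => f x + g x).
Proof.
move=> [mf [M fM]] [mg [N gN]]; split; first exact: measurable_funD.
by exists (M + N) => x; rewrite (le_trans (ler_normD _ _))// lerD.
Qed.

Lemma bdmeasM f g : bdmeas f -> bdmeas g -> bdmeas (fun x => f x * g x).
Proof.
move=> [mf [M fM]] [mg [N gN]]; split; first exact: measurable_funM.
by exists (M * N) => x; rewrite normrM ler_pM.
Qed.

Lemma bdmeasZ (c : R) f : bdmeas f -> bdmeas (fun x => c * f x).
Proof. by apply: bdmeasM; exact: bdmeas_cst. Qed.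

Lemma bdmeasN f : bdmeas f -> bdmeas (fun x => - f x).
Proof. by move=> /(bdmeasZ (-1)); under eq_fun do rewrite mulN1r. Qed.

Lemma bdmeasB f g : bdmeas f -> bdmeas g -> bdmeas (fun x => f x - g x).
Proof. by move=> bf /bdmeasN; exact: bdmeasD. Qed.

Lemma bdmeas_max f g : bdmeas f -> bdmeas g ->
  bdmeas (fun x => Num.max (f x) (g x)).
Proof.
move=> [mf [M fM]] [mg [N gN]]; split; first exact: measurable_maxr.
exists (M + N) => x; have := fM x; have := gN x.
have := le_trans (normr_ge0 _) (fM x); have := le_trans (normr_ge0 _) (gN x).
by case: (leP (f x) (g x)); lra.
Qed.

Lemma bdmeas_min f g : bdmeas f -> bdmeas g ->
  bdmeas (fun x => Num.min (f x) (g x)).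
Proof.
move=> bf bg; have := bdmeasN (bdmeas_max (bdmeasN bf) (bdmeasN bg)).
by under eq_fun do rewrite oppr_max !opprK.
Qed.

Lemma bdmeas_indic A : measurable A -> bdmeas (\1_A : T -> R).
Proof.
move=> mA; split; first exact: measurable_indic.
by exists 1 => x; rewrite indicE; case: (_ \in _); rewrite ?normr1 ?normr0.
Qed.

Lemma bdmeas_sum (I : Type) (r : seq I) (P : pred I) (F : I -> T -> R) :
  (forall i, P i -> bdmeas (F i)) -> bdmeas (fun x => \sum_(i <- r | P i) F i x).
Proof.
move=> bF; elim: r => [|i r IH].
  by under eq_fun do rewrite big_nil; exact: bdmeas_cst.
under eq_fun do rewrite big_cons.
by case: (boolP (P i)) => // Pi; apply: bdmeasD => //; exact: bF.
Qed.

Lemma bdmeas_prod (I : Type) (r : seq I) (P : pred I) (F : I -> T -> R) :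
  (forall i, P i -> bdmeas (F i)) -> bdmeas (fun x => \prod_(i <- r | P i) F i x).
Proof.
move=> bF; elim: r => [|i r IH].
  by under eq_fun do rewrite big_nil; exact: bdmeas_cst.
under eq_fun do rewrite big_cons.
by case: (boolP (P i)) => // Pi; apply: bdmeasM => //; exact: bF.
Qed.

Lemma bdmeas_expR f : bdmeas f -> bdmeas (fun x => expR (f x)).
Proof.
move=> [mf [M fM]]; split; first exact: measurableT_comp.
exists (expR M) => x; rewrite ger0_norm ?expR_ge0// ler_expR.
by rewrite (le_trans (ler_norm _)).
Qed.

Lemma bdmeas_comp f (S : T -> T) : measurable_fun setT S -> bdmeas f ->
  bdmeas (fun x => f (S x)).
Proof.
by move=> mS [mf [M fM]]; split; [exact: measurableT_comp|exists M].
Qed.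

Lemma bdmeas_integrable f : bdmeas f -> mu.-integrable setT (EFin \o f).
Proof.
move=> [mf [M fM]]; apply: measurable_bounded_integrable => //.
  by rewrite (le_lt_trans (probability_le1 mu _))// ltry.
exists M; split; first exact: num_real.
by move=> x Mx t _ /=; rewrite (le_trans (fM t))// ltW.
Qed.

Definition mean f : R := \int[mu]_x f x.

Lemma meanD f g : bdmeas f -> bdmeas g ->
  mean (fun x => f x + g x) = mean f + mean g.
Proof. by move=> bf bg; rewrite /mean RintegralD//; exact: bdmeas_integrable. Qed.

Lemma meanB f g : bdmeas f -> bdmeas g ->
  mean (fun x => f x - g x) = mean f - mean g.
Proof. by move=> bf bg; rewrite /mean RintegralB//; exact: bdmeas_integrable. Qed.

Lemma meanZ (c : R) f : bdmeas f -> mean (fun x => c * f x) = c * mean f.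
Proof. by move=> bf; rewrite /mean RintegralZl//; exact: bdmeas_integrable. Qed.

Lemma meanN f : bdmeas f -> mean (fun x => - f x) = - mean f.
Proof.
by move=> bf; rewrite -mulN1r -meanZ//; congr mean; apply/funext=> x; rewrite mulN1r.
Qed.

Lemma mean_cst (c : R) : mean (cst c) = c.
Proof.
by rewrite /mean Rintegral_cst//= probability_setT mulr1.
Qed.

Lemma mean_le f g : bdmeas f -> bdmeas g -> (forall x, f x <= g x) ->
  mean f <= mean g.
Proof. by move=> bf bg fg; apply: le_Rintegral => //; exact: bdmeas_integrable. Qed.

Lemma mean_ge0 f : (forall x, 0 <= f x) -> 0 <= mean f.
Proof. by move=> f0; exact: Rintegral_ge0. Qed.

Lemma mean_indic A : measurable A -> mean (\1_A : T -> R) = fine (mu A).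
Proof. by move=> mA; rewrite /mean /Rintegral integral_indic// setIT. Qed.

Lemma mean_sum (I : Type) (r : seq I) (P : pred I) (F : I -> T -> R) :
  (forall i, P i -> bdmeas (F i)) ->
  mean (fun x => \sum_(i <- r | P i) F i x) = \sum_(i <- r | P i) mean (F i).
Proof.
move=> bF; elim: r => [|i r IH].
  rewrite big_nil -[RHS](mean_cst 0).
  by congr mean; apply/funext => x; rewrite big_nil.
rewrite big_cons; case: ifPn => Pi.
  rewrite -IH -meanD//; [|exact: bF|exact: bdmeas_sum].
  by congr mean; apply/funext => x; rewrite big_cons Pi.
by rewrite -IH; congr mean; apply/funext => x; rewrite big_cons (negbTE Pi).
Qed.

Lemma mean_cvg (h : nat -> T -> R) f (M : R) :
  (forall n, measurable_fun setT (h n)) -> (forall n x, `|h n x| <= M) ->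
  (forall x, h ^~ x @ \oo --> f x) ->
  bdmeas f /\ (fun n => mean (h n)) @ \oo --> mean f.
Proof.
move=> mh hM hf.
have mf : measurable_fun setT f by apply: measurable_fun_cvg => // x _; exact: hf.
have bf : bdmeas f.
  split=> //; exists M => x; apply: cvgr_to_le (cvg_norm (hf x)) _.
  by apply: nearW => n; exact: hM.
split=> //.
have [|||||_ _ /= cvi] := @dominated_convergence _ T R mu setT measurableT
    (fun n x => (h n x)%:E) (EFin \o f) (cst M%:E).
- by move=> n; exact/measurable_EFinP.
- exact/measurable_EFinP.
- by apply: aeW => x _; apply: cvg_EFin; [exact: nearW|exact: hf].
- exact: (bdmeas_integrable (bdmeas_cst M)).
- by apply: aeW => x n _ /=; rewrite lee_fin.
- apply: fine_cvg; rewrite /mean fineK//.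
  exact: integrable_fin_num (bdmeas_integrable bf).
Qed.

Lemma mean_eq0_ae f : bdmeas f -> (forall x, 0 <= f x) -> mean f = 0 ->
  {ae mu, forall x, f x = 0}.
Proof.
move=> bf f0 mf0.
have i0 : (\int[mu]_x `|(EFin \o f) x| = 0)%E.
  under eq_integral => x _ do rewrite /= ger0_norm//.
  rewrite -[LHS]fineK; first by congr EFin; exact: mf0.
  exact: integrable_fin_num (bdmeas_integrable bf).
have [+ _] := ae_eq_integral_abs mu measurableT (f := EFin \o f)
  ((measurable_EFinP _ _).2 bf.1).
by move=> /(_ i0); apply: filterS => x /= /(_ I) [].
Qed.

(** * Maximal inequalities for a measure preserving map *)

Section Invariant.
Variable S : T -> T.
Hypothesis mS : measurable_fun setT S.
Hypothesis invS : forall A, measurable A -> mu (S @^-1` A) = mu A.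

Lemma mean_comp f : bdmeas f -> mean (fun x => f (S x)) = mean f.
Proof.
move=> bf; rewrite /mean /Rintegral; congr fine.
rewrite -[LHS](@integral_pushforward _ _ _ _ _ S mS mu setT (EFin \o f))//=.
- by apply: eq_measure_integral => A mA _; exact: invS.
- exact: (measurable_EFinP _ _).2 bf.1.
- exact: (bdmeas_integrable (bdmeas_comp mS bf)).
Qed.

Lemma measurable_iter n : measurable_fun setT (iter n S).
Proof.
elim: n => [|n IH]; first exact: measurable_id.
exact: (measurableT_comp mS IH).
Qed.

Lemma birkhoff_sumS f n x :
  birkhoff_sum S f n.+1 x = f x + birkhoff_sum S f n (S x).
Proof.
rewrite /birkhoff_sum big_ord_recl/=; congr (_ + _).
by apply: eq_bigr => i _; rewrite -iterSr.
Qed.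

Lemma bdmeas_birkhoff_sum f n : bdmeas f -> bdmeas (birkhoff_sum S f n).
Proof.
by move=> bf; apply: bdmeas_sum => i _; apply: bdmeas_comp => //; exact: measurable_iter.
Qed.

(** The largest of the Birkhoff sums at [x] of lengths [0] to [n], in the recursive form that
    Garsia's argument uses. *)
Fixpoint birkhoff_max f n x : R :=
  if n is n'.+1 then Num.max 0 (f x + birkhoff_max f n' (S x)) else 0.

Lemma birkhoff_max_ge0 f n x : 0 <= birkhoff_max f n x.
Proof. by case: n => [|n] //=; rewrite le_max lexx. Qed.

Lemma bdmeas_birkhoff_max f n : bdmeas f -> bdmeas (birkhoff_max f n).
Proof.
move=> bf; elim: n => [|n IH] /=; first exact: bdmeas_cst.
apply: bdmeas_max; first exact: bdmeas_cst.
by apply: bdmeasD => //; exact: bdmeas_comp.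
Qed.

Lemma birkhoff_max_nd f x : {homo birkhoff_max f ^~ x : m n / (m <= n)%N >-> m <= n}.
Proof.
apply: homo_leq => [//|? ? ?|n]; first exact: le_trans.
elim: n x => [|n IH] x /=; first by rewrite le_max lexx.
by rewrite ge_max le_max lexx/= le_max lerD2l IH orbT.
Qed.

Lemma birkhoff_sum_le_max f n x : birkhoff_sum S f n x <= birkhoff_max f n x.
Proof.
elim: n x => [|n IH] x; first by rewrite /birkhoff_sum big_ord0.
by rewrite birkhoff_sumS /= le_max lerD2l IH orbT.
Qed.

Definition max_pos f n := [set x | 0 < birkhoff_max f n x].

Lemma measurable_max_pos f n : bdmeas f -> measurable (max_pos f n).
Proof.
move=> /(bdmeas_birkhoff_max n)[mf _].
rewrite (_ : max_pos f n = setT `&` birkhoff_max f n @^-1` `]0, +oo[%classic).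
  by apply: mf => //; exact: measurable_itv.
by apply/seteqP; split => x; rewrite /max_pos /= in_itv/= andbT; [|case].
Qed.

(* Garsia: where [M_(n+1) > 0] one has [f = M_(n+1) - M_n \o S], elsewhere
   the right-hand side is nonpositive. *)
Lemma maximal_ergodic f n : bdmeas f ->
  0 <= mean (fun x => f x * \1_(max_pos f n) x).
Proof.
move=> bf; case: n => [|n].
  apply: mean_ge0 => x; rewrite indicE memNset ?mulr0// /max_pos /=.
  by rewrite ltxx.
have bM m := bdmeas_birkhoff_max m bf.
apply: (@le_trans _ _
  (mean (fun x => birkhoff_max f n.+1 x - birkhoff_max f n (S x)))).
  rewrite meanB//; last by exact: bdmeas_comp.
  rewrite mean_comp// subr_ge0; apply: mean_le => // x.
  exact: birkhoff_max_nd.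
apply: mean_le.
- by apply: bdmeasB => //; exact: bdmeas_comp.
- by apply: bdmeasM => //; apply: bdmeas_indic; exact: measurable_max_pos.
move=> x; rewrite indicE.
have [/set_mem|/negP xn] := boolP (x \in max_pos f n.+1).
  rewrite /max_pos/= lt_max ltxx/= => p; rewrite mulr1.
  by rewrite (max_idPr _) ?addrK// ltW.
rewrite mulr0 subr_le0 (le_trans _ (birkhoff_max_ge0 _ _ _))// leNgt.
by apply/negP => p; apply: xn; exact: mem_set.
Qed.

(** The sets [max_pos f n] increase to the whole space, and the maximal inequality passes to the
    limit by bounded convergence. *)
Lemma maximal_ergodic_ge0 f : bdmeas f ->
  (forall x, exists2 n, (0 < n)%N & 0 < birkhoff_sum S f n x) -> 0 <= mean f.
Proof.
move=> bf f0; have [M fM] := bf.2.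
have [|||_] := @mean_cvg (fun n x => f x * \1_(max_pos f n) x) f M.
- move=> n; have [] // : bdmeas (fun x => f x * \1_(max_pos f n) x).
  by apply: bdmeasM => //; apply: bdmeas_indic; exact: measurable_max_pos.
- move=> n x; rewrite indicE normrM.
  by case: (_ \in _); rewrite ?normr1 ?normr0 ?mulr1 ?mulr0// (le_trans (normr_ge0 _) (fM x)).
- move=> x; have [n n0 fn] := f0 x; apply: cvg_near_cst; exists n => // m /= nm.
  rewrite indicE mem_set ?mulr1// /max_pos /= (lt_le_trans fn)//.
  by rewrite (le_trans (birkhoff_sum_le_max _ _ _))//; exact: birkhoff_max_nd.
by move=> /cvgr_to_ge; apply; apply: nearW => n; exact: maximal_ergodic.
Qed.

Lemma birkhoff_sumB f g n x : birkhoff_sum S (fun y => f y - g y) n x =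
  birkhoff_sum S f n x - birkhoff_sum S g n x.
Proof. by rewrite /birkhoff_sum sumrB. Qed.

Lemma birkhoff_sum_cst (c : R) n x : birkhoff_sum S (cst c) n x = n%:R * c.
Proof. by rewrite /birkhoff_sum sumr_const card_ord mulr_natl. Qed.

Lemma measurable_lt f g : bdmeas f -> bdmeas g -> measurable [set x | f x < g x].
Proof.
move=> [mf _] [mg _]; rewrite -[X in measurable X]setTI.
rewrite [X in setT `&` X](_ : _ = (fun x => f x < g x) @^-1` [set true]).
  exact: (measurable_fun_ltr mf mg).
by apply/seteqP; split => x /=; case: (_ < _).
Qed.

(** The set where the maximal function of [\1_V] exceeds [delta]; the inequality is strict, so
    [n = 0] contributes nothing. *)
Definition often_in V (delta : R) :=
  \bigcup_n [set x | delta * n%:R < birkhoff_sum S \1_V n x].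

Lemma measurable_often_in V delta : measurable V -> measurable (often_in V delta).
Proof.
move=> mV; apply: bigcupT_measurable => n; apply: measurable_lt.
  exact: bdmeas_cst.
by apply: bdmeas_birkhoff_sum; exact: bdmeas_indic.
Qed.

(** For positive [delta], the maximal inequality for [\1_V - delta] bounds [delta] times the mass of
    each [max_pos] set by the mass of [V], and these sets increase to one containing
    [often_in V delta]. *)
Lemma often_in_le V (delta : R) : measurable V ->
  delta * fine (mu (often_in V delta)) <= fine (mu V).
Proof.
move=> mV; case: (leP delta 0) => [d0|d0].
  by rewrite (@le_trans _ _ 0)// ?fine_ge0// mulr_le0_ge0// fine_ge0.
pose h x : R := \1_V x - delta.
have bh : bdmeas h by apply: bdmeasB; [exact: bdmeas_indic|exact: bdmeas_cst].
have mE n := measurable_max_pos n bh.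
have mUE : measurable (\bigcup_n max_pos h n) by exact: bigcupT_measurable.
have sub : often_in V delta `<=` \bigcup_n max_pos h n.
  move=> x [n _ /= dn]; exists n => //; rewrite /max_pos/=.
  rewrite (lt_le_trans _ (birkhoff_sum_le_max _ _ _))//.
  by rewrite birkhoff_sumB birkhoff_sum_cst subr_gt0 mulrC.
have le_n n : delta * fine (mu (max_pos h n)) <= fine (mu V).
  have bE := bdmeas_indic (mE n).
  have bV := bdmeas_indic mV.
  rewrite -(mean_indic (mE n)) -(mean_indic mV) -meanZ//.
  rewrite -subr_ge0 -meanB//; last exact: bdmeasZ.
  apply: (le_trans (maximal_ergodic n bh)); apply: mean_le.
  - exact: bdmeasM.
  - by apply: bdmeasB => //; exact: bdmeasZ.
  move=> x; rewrite /h mulrBl lerD2r !indicE.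
  by case: (_ \in _); case: (_ \in _); rewrite ?mulr1 ?mulr0.
have mUle : delta * fine (mu (\bigcup_n max_pos h n)) <= fine (mu V).
  have cv : (fine \o (mu \o max_pos h)) @ \oo --> fine (mu (\bigcup_n max_pos h n)).
    apply: fine_cvg; rewrite fineK ?fin_num_measure//.
    apply: nondecreasing_cvg_mu => // m n mn; apply/subsetPset => x.
    by rewrite /max_pos/= => /lt_le_trans; apply; exact: birkhoff_max_nd.
  apply: cvgr_to_le (cvgM (cvg_cst delta) cv) _.
  by apply: nearW => n; exact: le_n.
apply: le_trans mUle; rewrite ler_pM2l// fine_le ?fin_num_measure//.
- exact: measurable_often_in.
- by apply: le_measure => //; apply: mem_set => //; exact: measurable_often_in.
Qed.

End Invariant.

End BoundedMeasurable.

(** * Birkhoff's theorem *)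

Section LimSup.
Context {R : realType}.
Variables (u : nat -> R) (M : R).
Hypothesis uM : forall n, `|u n| <= M.

Let ub : has_ubound (range u).
Proof. by exists M => _ [n _ <-]; rewrite (le_trans (ler_norm _)). Qed.

Let lb : has_lbound (range u).
Proof. by exists (- M) => _ [n _ <-]; have := uM n; rewrite ler_norml => /andP[]. Qed.

Let limn_sup_cvg : sups u @ \oo --> limn_sup u.
Proof.
have h := cvg_sups_inf ub lb.
by rewrite /limn_sup (cvg_lim _ h).
Qed.

Lemma limn_sup_lt (e : R) : 0 < e -> \forall n \near \oo, u n < limn_sup u + e.
Proof.
move=> e0; have : \forall n \near \oo, sups u n < limn_sup u + e.
  by apply: cvgr_lt limn_sup_cvg _ _; rewrite ltrDl.
move=> [N _ h]; exists N => // n /= Nn; apply: le_lt_trans (h N (leqnn N)).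
by apply: ub_le_sup; [exact: has_ubound_sdrop|exists n].
Qed.

Lemma limn_sup_gt (e : R) (N : nat) : 0 < e ->
  exists2 n, (N <= n)%N & limn_sup u - e < u n.
Proof.
move=> e0; have hs : limn_sup u <= sups u N.
  apply: cvgr_to_le limn_sup_cvg _; exists N => // n /= Nn.
  exact: nonincreasing_sups.
have [|_ [n /= Nn <-] h] := @sup_adherent R (sdrop u N) e e0.
  by split; [exists (u N); exists N => /=|exact: has_ubound_sdrop].
by exists n => //; rewrite (le_lt_trans _ h)// lerD2r.
Qed.

Lemma limn_sup_norm_le : `|limn_sup u| <= M.
Proof.
apply: cvgr_to_le (cvg_norm limn_sup_cvg) _; apply: nearW => n.
rewrite ler_norml; apply/andP; split.
  apply: (@le_trans _ _ (u n)); first by have := uM n; rewrite ler_norml => /andP[].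
  by apply: ub_le_sup; [exact: has_ubound_sdrop|exists n => /=].
apply: ge_sup; first by exists (u n); exists n => /=.
by move=> _ [m _ <-]; rewrite (le_trans (ler_norm _)).
Qed.

End LimSup.

(** Meant for the Birkhoff averages [u] at [x] and [v] at [S x]: with the reverse inequality below,
    it makes their upper limit invariant. *)
Lemma limn_sup_le_shift (R : realType) (u v : nat -> R) (M : R) :
  (forall n, `|u n| <= M) -> (forall n, `|v n| <= M) ->
  (fun n => u n.+1 - v n) @ \oo --> (0 : R) -> limn_sup u <= limn_sup v.
Proof.
move=> uM vM uv0; apply/ler_addgt0Pr => e e0.
have e3 : 0 < e / 3 by rewrite divr_gt0.
have [N1 _ h1] := limn_sup_lt vM e3.
have : \forall n \near \oo, u n.+1 - v n < e / 3 by apply: cvgr_lt uv0 _ _.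
move=> [N2 _ h2].
(* The bound on the index is a successor, so the index found can be written [n.+1] and compared with
   [v n]. *)
have [[//|n] nN hn] := limn_sup_gt uM (maxn N1 N2).+1 e3.
rewrite ltnS geq_max in nN; case/andP: nN => /h1 /= a1 /h2 /= a2.
lra.
Qed.

Lemma limn_sup_ge_shift (R : realType) (u v : nat -> R) (M : R) :
  (forall n, `|u n| <= M) -> (forall n, `|v n| <= M) ->
  (fun n => u n.+1 - v n) @ \oo --> (0 : R) -> limn_sup v <= limn_sup u.
Proof.
move=> uM vM uv0; apply/ler_addgt0Pr => e e0.
have e3 : 0 < e / 3 by rewrite divr_gt0.
have [N1 _ h1] := limn_sup_lt uM e3.
have : \forall n \near \oo, - (e / 3) < u n.+1 - v n.
  by apply: cvgr_gt uv0 _ _; rewrite oppr_lt0.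
move=> [N2 _ h2].
have [n nN hn] := limn_sup_gt vM (maxn N1 N2) e3.
rewrite geq_max in nN; case/andP: nN => /leqW/h1 /= a1 /h2 /= a2.
lra.
Qed.

Section Birkhoff.
Context d (T : measurableType d) (R : realType) (mu : probability T R).
Variable S : T -> T.
Hypothesis mS : measurable_fun setT S.
Hypothesis invS : forall A, measurable A -> mu (S @^-1` A) = mu A.
Implicit Types (f g : T -> R).

Definition birkhoff_mean f n x : R := n%:R^-1 * birkhoff_sum S f n x.

Lemma birkhoff_mean_bound f (M : R) n x : (forall y, `|f y| <= M) ->
  `|birkhoff_mean f n x| <= M.
Proof.
move=> fM; have M0 : 0 <= M := le_trans (normr_ge0 _) (fM x).
case: n => [|n]; first by rewrite /birkhoff_mean invr0 mul0r normr0.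
rewrite /birkhoff_mean normrM ger0_norm// ler_pdivrMl//.
rewrite (le_trans (ler_norm_sum _ _ _))//.
apply: (@le_trans _ _ (\sum_(i < n.+1) M)); first by apply: ler_sum.
by rewrite sumr_const card_ord mulr_natl.
Qed.

(** For positive [n] the difference is [(f x - birkhoff_mean f n (S x)) / (n + 1)], at most
    [2 M / (n + 1)] in absolute value. *)
Lemma birkhoff_mean_shift f (M : R) x : (forall y, `|f y| <= M) ->
  (fun n => birkhoff_mean f n.+1 x - birkhoff_mean f n (S x)) @ \oo --> (0 : R).
Proof.
move=> fM.
have M0 : 0 <= M := le_trans (normr_ge0 _) (fM x).
apply/cvgr0Pnorm_le => e e0; near=> n.
have n0 : (0 < n)%N by near: n; exists 1%N.
have -> : birkhoff_mean f n.+1 x - birkhoff_mean f n (S x) =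
    n.+1%:R^-1 * (f x - birkhoff_mean f n (S x)).
  rewrite /birkhoff_mean birkhoff_sumS -natr1; field.
  by rewrite natr1 !pnatr_eq0 -lt0n n0.
rewrite normrM ger0_norm// ler_pdivrMl//.
apply: (@le_trans _ _ (M + M)).
  by rewrite (le_trans (ler_normB _ _))// lerD//; exact: birkhoff_mean_bound.
rewrite -ler_pdivrMr//; apply: (@le_trans _ _ n%:R); last by rewrite ler_nat.
near: n; exact: nbhs_infty_ger.
Unshelve. all: by end_near. Qed.

Lemma bdmeas_birkhoff_mean f n : bdmeas f -> bdmeas (birkhoff_mean f n).
Proof. by move=> bf; apply: bdmeasZ; exact: bdmeas_birkhoff_sum. Qed.

(** Take for [F] the upper limit of the averages, which is invariant. At every point some Birkhoff
    sum of [f - (F - e)] is positive, so this function has nonnegative mean for every [e > 0]. *)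
Lemma birkhoff_upper f : bdmeas f -> exists F, [/\ bdmeas F, mean mu F <= mean mu f &
  forall x (e : R), 0 < e -> \forall n \near \oo, birkhoff_mean f n x < F x + e].
Proof.
move=> bf; have [mf [M fM]] := bf.
have bM n x := birkhoff_mean_bound n x fM.
pose F x := limn_sup (birkhoff_mean f ^~ x).
have FS x : F (S x) = F x.
  apply/eqP; rewrite eq_le; apply/andP; split.
    exact: limn_sup_ge_shift (bM ^~ x) (bM ^~ (S x)) (birkhoff_mean_shift x fM).
  exact: limn_sup_le_shift (bM ^~ x) (bM ^~ (S x)) (birkhoff_mean_shift x fM).
have Fiter x l : F (iter l S x) = F x by elim: l => //= l IH; rewrite FS.
have bF : bdmeas F.
  split; last by exists M => x; exact: limn_sup_norm_le (bM ^~ x).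
  apply: measurable_fun_limn_sup => [x _|x _|n].
  - by exists M => _ [n _ <-]; rewrite (le_trans (ler_norm _)).
  - by exists (- M) => _ [n _ <-]; have := bM n x; rewrite ler_norml => /andP[].
  - by have [] := bdmeas_birkhoff_mean n bf.
exists F; split=> //; last by move=> x e; exact: limn_sup_lt (bM ^~ x) e.
apply/ler_addgt0Pr => e e0; rewrite -subr_ge0.
have bFe : bdmeas (fun x => F x - e) by apply: bdmeasB => //; exact: bdmeas_cst.
have -> : mean mu f + e - mean mu F = mean mu (fun x => f x - (F x - e)).
  rewrite meanB// meanB//; last exact: bdmeas_cst.
  by rewrite mean_cst; ring.
apply: (maximal_ergodic_ge0 mS invS); first exact: bdmeasB.
move=> x; have [n n0 hn] := limn_sup_gt (bM ^~ x) 1 e0.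
exists n => //; rewrite birkhoff_sumB subr_gt0.
have -> : birkhoff_sum S (fun y => F y - e) n x = n%:R * (F x - e).
  rewrite /birkhoff_sum (eq_bigr (fun=> F x - e)); last by move=> i _; rewrite Fiter.
  by rewrite sumr_const card_ord mulr_natl.
by move: hn; rewrite /birkhoff_mean ltr_pdivlMl// ltr0n.
Qed.

(** The upper bounds [F] for [f] and [G] for [- f] satisfy [F + G >= 0] everywhere, while [F + G]
    has mean at most [0]; so [G = - F] almost everywhere, which squeezes the averages. *)
Theorem birkhoff f : bdmeas f -> exists F, [/\ bdmeas F, mean mu F = mean mu f &
  {ae mu, forall x, birkhoff_mean f ^~ x @ \oo --> F x}].
Proof.
move=> bf; have [F [bF mF Fup]] := birkhoff_upper bf.
have [G [bG mG Gup]] := birkhoff_upper (bdmeasN bf).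
have GE n x : birkhoff_mean (fun y => - f y) n x = - birkhoff_mean f n x.
  by rewrite /birkhoff_mean /birkhoff_sum sumrN mulrN.
rewrite meanN// in mG.
have bFG : bdmeas (fun x => F x + G x) by exact: bdmeasD.
have FG0 x : 0 <= F x + G x.
  apply/ler_addgt0Pr => e e0.
  have e2 : 0 < e / 2 by rewrite divr_gt0.
  have [n [a b]] := filter_ex (filterI (Fup x _ e2) (Gup x _ e2)).
  by move: b; rewrite GE => b; lra.
have mFG : mean mu (fun x => F x + G x) = 0.
  apply/eqP; rewrite eq_le mean_ge0// andbT meanD//; lra.
have h := mean_eq0_ae bFG FG0 mFG.
exists F; split=> //.
  have := meanD mu bF bG; rewrite mFG; lra.
apply: filterS h => x FG; apply/cvgrPdist_lt => e e0.
near=> n.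
have a : birkhoff_mean f n x < F x + e by near: n; exact: Fup.
have b : - birkhoff_mean f n x < G x + e by rewrite -GE; near: n; exact: Gup.
by rewrite ltr_distlC; apply/andP; split; lra.
Unshelve. all: by end_near. Qed.

End Birkhoff.

(** * Finite-valued functions and conditional information *)

Section FiniteValued.
Context d (T : measurableType d) (R : realType) (mu : probability T R).

(** Finite partitions are encoded as measurable maps to a finite type, so that the cell of a point
    is a value to compute with. *)
Definition finmeas (W : finType) (V : T -> W) :=
  forall w, measurable (V @^-1` [set w]).

Definition law (W : finType) (V : T -> W) (w : W) : R :=
  fine (mu (V @^-1` [set w])).

Lemma law_ge0 (W : finType) (V : T -> W) w : 0 <= law V w.
Proof. exact: fine_ge0. Qed.

Lemma fin_comp_sum (W : finType) (V : T -> W) (F : W -> R) x :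
  F (V x) = \sum_w F w * \1_(V @^-1` [set w]) x.
Proof.
rewrite (bigD1 (V x))//= big1 ?addr0; last first.
  move=> w wV; rewrite indicE memNset ?mulr0// => /= e.
  by move: wV; rewrite e eqxx.
by rewrite indicE mem_set ?mulr1.
Qed.

Lemma bdmeas_fin (W : finType) (V : T -> W) (F : W -> R) : finmeas V ->
  bdmeas (fun x => F (V x)).
Proof.
move=> mV; under eq_fun do rewrite fin_comp_sum.
by apply: bdmeas_sum => w _; apply: bdmeasZ; apply: bdmeas_indic.
Qed.

Lemma mean_fin (W : finType) (V : T -> W) (F : W -> R) : finmeas V ->
  mean mu (fun x => F (V x)) = \sum_w F w * law V w.
Proof.
move=> mV; under eq_fun do rewrite fin_comp_sum.
rewrite mean_sum; last first.
  by move=> w _; apply: bdmeasZ; apply: bdmeas_indic.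
apply: eq_bigr => w _; rewrite meanZ ?mean_indic//.
by apply: bdmeas_indic.
Qed.

Lemma law_mean (W : finType) (V : T -> W) w : finmeas V ->
  law V w = mean mu (fun x => (V x == w)%:R).
Proof.
move=> mV; rewrite (mean_fin (fun v => (v == w)%:R) mV) (bigD1 w)//= eqxx mul1r.
by rewrite big1 ?addr0// => v /negbTE ->; rewrite mul0r.
Qed.

Lemma sum_law (W : finType) (V : T -> W) : finmeas V -> \sum_w law V w = 1.
Proof.
move=> mV; rewrite -[RHS](mean_cst mu 1) (mean_fin (fun=> 1) mV).
by apply: eq_bigr => w _; rewrite mul1r.
Qed.

Lemma finmeas_comp (W W' : finType) (V : T -> W) (r : W -> W') : finmeas V ->
  finmeas (fun x => r (V x)).
Proof.
move=> mV w'; rewrite (_ : _ @^-1` _ =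
    \bigcup_(w in [set w | r w = w']) (V @^-1` [set w])).
  by apply: fin_bigcup_measurable => // w _; exact: mV.
by apply/seteqP; split => [x /= rV|x [w /= <- <-]] //; exists (V x).
Qed.

Lemma finmeas_pair (W W' : finType) (V : T -> W) (V' : T -> W') :
  finmeas V -> finmeas V' -> finmeas (fun x => (V x, V' x)).
Proof.
move=> mV mV' [w w'].
rewrite (_ : _ @^-1` _ = (V @^-1` [set w]) `&` (V' @^-1` [set w'])).
  by apply: measurableI; [exact: mV|exact: mV'].
by apply/seteqP; split => x /=; [case=> -> ->|case=> -> ->].
Qed.

Lemma law_pair_marginal (I W : finType) (N : T -> I) (V : T -> W) w :
  finmeas N -> finmeas V -> \sum_i law (fun x => (N x, V x)) (i, w) = law V w.
Proof.
move=> mN mV; have mNV := finmeas_pair mN mV.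
rewrite law_mean// (mean_fin (fun p => (p.2 == w)%:R) mNV).
transitivity (\sum_i \sum_v (v == w)%:R * law (fun x => (N x, V x)) (i, v)).
  apply: eq_bigr => i _; rewrite (bigD1 w)//= eqxx mul1r.
  by rewrite big1 ?addr0// => v /negbTE ->; rewrite mul0r.
by rewrite pair_bigA; apply: eq_bigr => -[].
Qed.

Lemma law_pair_le (I W : finType) (N : T -> I) (V : T -> W) i w :
  finmeas N -> finmeas V -> law (fun x => (N x, V x)) (i, w) <= law V w.
Proof.
move=> mN mV; rewrite -(law_pair_marginal w mN mV) (bigD1 i)//= lerDl.
by apply: sumr_ge0 => j _; exact: law_ge0.
Qed.

Lemma law_fibre (W W' : finType) (V : T -> W) (V' : T -> W') x :
  (forall y, V y = V x <-> V' y = V' x) -> law V (V x) = law V' (V' x).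
Proof.
by move=> h; rewrite /law; congr (fine (mu _)); apply/seteqP; split=> y /= /h.
Qed.

Section Conditional.
Variables (I W W' : finType) (N : T -> I) (V : T -> W) (V' : T -> W').
Hypotheses (mN : finmeas N) (mV : finmeas V) (mV' : finmeas V').

(** Off null cells, minus the logarithm of the conditional probability of [N x] given [V x]. *)
Definition cond_info x : R :=
  ln (law V (V x)) - ln (law (fun y => (N y, V y)) (N x, V x)).

Lemma bdmeas_cond_info : bdmeas cond_info.
Proof.
apply: (@bdmeas_fin _ (fun y => (N y, V y))
  (fun p => ln (law V p.2) - ln (law (fun y => (N y, V y)) p))).
exact: finmeas_pair.
Qed.

Lemma mean_cond_info_ge0 : 0 <= mean mu cond_info.
Proof.
have mNV := finmeas_pair mN mV.
rewrite (mean_fin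
  (fun p => ln (law V p.2) - ln (law (fun y => (N y, V y)) p)) mNV).
apply: sumr_ge0 => -[i w] _ /=.
have := law_ge0 (fun y => (N y, V y)) (i, w); rewrite le_eqVlt => /predU1P[<-|p0].
  by rewrite mulr0.
rewrite mulr_ge0 ?law_ge0// subr_ge0 ler_ln ?posrE//; first exact: law_pair_le.
by rewrite (lt_le_trans p0)//; exact: law_pair_le.
Qed.

(* The factor [e^info] is the inverse of the conditional probability of the
   name given [V], so that it integrates to at most one given [V]. Truncation at
   [0] only matters on null cells, where [ln 0 = 0] can make [info] negative. *)
Lemma mean_expR_cond_info (F : I -> W -> R) :
  (forall i w, 0 <= F i w) ->
  mean mu (fun x => F (N x) (V x) * expR (Num.max 0 (cond_info x)))
    <= mean mu (fun x => \sum_i F i (V x)).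
Proof.
move=> F0; have mNV := finmeas_pair mN mV.
rewrite (mean_fin (fun p => F p.1 p.2 * expR (Num.max 0
  (ln (law V p.2) - ln (law (fun y => (N y, V y)) p)))) mNV).
rewrite (mean_fin (fun w => \sum_i F i w) mV).
under [leRHS]eq_bigr do rewrite mulr_suml.
rewrite exchange_big/= pair_bigA/=.
apply: ler_sum => -[i w] _ /=; rewrite -mulrA ler_wpM2l//.
have le := law_pair_le i w mN mV.
have := law_ge0 (fun y => (N y, V y)) (i, w); rewrite le_eqVlt => /predU1P[<-|p0].
  by rewrite mulr0; exact: law_ge0.
have v0 := lt_le_trans p0 le.
rewrite maxEle; case: ifP => _; last by rewrite expR0 mul1r.
by rewrite expRD expRN !lnK ?posrE// mulfVK// gt_eqF.
Qed.

End Conditional.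
End FiniteValued.

(** The excess [expR (- y) - 1 + y] is convex in [y]; its tangent line at [z] has slope
    [1 - expR (- z)] and lies above [(1 - expR (- z)) * (y - z)]. A bound on a mean excess thus
    becomes one on a positive part. *)
Lemma drop_le (R : realType) (z y : R) : 0 < z ->
  Num.max 0 y <= z + (expR (- y) - 1 + y) / (1 - expR (- z)).
Proof.
move=> z0.
have q0 : 0 < 1 - expR (- z) by rewrite subr_gt0 expR_lt1 oppr_lt0.
have hy := expR_ge1Dx (- y).
have hz := expR_ge1Dx (- z).
rewrite ge_max; apply/andP; split.
  by apply: addr_ge0; [exact: ltW|apply: divr_ge0; [lra|exact: ltW]].
rewrite -lerBlDl ler_pdivlMr//.
(* the tangent line of [expR (- y)] at [z] *)
have h : expR (- z) * (1 + (z - y)) <= expR (- y).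
  have -> : expR (- y) = expR (- z + (z - y)) by congr expR; ring.
  by rewrite expRD; apply: ler_wpM2l; [exact: expR_ge0|exact: expR_ge1Dx].
nra.
Qed.

(** * Conditional information when the conditioning partition is refined *)

Section Refine.
Context d (T : measurableType d) (R : realType) (mu : probability T R).
Variables (I W W' : finType) (N : T -> I) (V : T -> W) (V' : T -> W') (r : W' -> W).
Hypotheses (mN : finmeas N) (mV' : finmeas V') (VE : forall x, V x = r (V' x)).

Let mV : finmeas V.
Proof. by rewrite (_ : V = fun x => r (V' x)); [exact: finmeas_comp|apply/funext]. Qed.

Let info := cond_info mu N V.
Let info' := cond_info mu N V'.

(** Off null cells, [expR (info' - info)] is the conditional probability of the name given [V]
    divided by that given the finer [V']. Summed against the joint law of [N] and [V'], it leaves in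
    each cell of [V'] the mass of the cell times a conditional distribution. *)
Lemma mean_expR_cond_info_diff : mean mu (fun x => expR (info' x - info x)) <= 1.
Proof.
have mNV' := finmeas_pair mN mV'.
pose Q := law mu (fun y => (N y, V y)).
pose Q' := law mu (fun y => (N y, V' y)).
rewrite /info /info' /cond_info.
under eq_fun do rewrite VE.
rewrite (mean_fin mu (fun p => expR (ln (law mu V' p.2) - ln (Q' p)
   - (ln (law mu V (r p.2)) - ln (Q (p.1, r p.2))))) mNV').
apply: (@le_trans _ _ (\sum_i \sum_w law mu V' w * (Q (i, r w) / law mu V (r w)))).
  rewrite pair_bigA; apply: ler_sum => -[i w] _ /=.
  have := law_ge0 mu (fun y => (N y, V' y)) (i, w).
  rewrite le_eqVlt => /predU1P[<-|p0].
    by rewrite mulr0 mulr_ge0 ?divr_ge0 ?law_ge0.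
  have v0 := lt_le_trans p0 (law_pair_le mu i w mN mV').
  have pQ : Q' (i, w) <= Q (i, r w).
    have m1 := finmeas_pair mN mV' (i, w).
    have m2 := finmeas_pair mN mV (i, r w).
    apply: fine_le; [exact: fin_num_measure|exact: fin_num_measure|].
    apply: le_measure; [exact: mem_set|exact: mem_set|].
    by move=> x /= [-> <-]; rewrite VE.
  have q0 := lt_le_trans p0 pQ.
  have w0 := lt_le_trans q0 (law_pair_le mu i (r w) mN mV).
  rewrite !expRD !expRN !expRD !expRN !lnK ?posrE//.
  rewrite le_eqVlt; apply/orP; left; apply/eqP.
  by rewrite /Q'; field; rewrite !gt_eqF.
rewrite exchange_big/= -(sum_law mu mV'); apply: ler_sum => w _.
rewrite -mulr_sumr -mulr_suml (law_pair_marginal mu (r w) mN mV).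
have [->|w0] := eqVneq (law mu V (r w)) 0.
  by rewrite mul0r mulr0; exact: law_ge0.
by rewrite divff// mulr1.
Qed.

Let binfo : bdmeas info. Proof. exact: bdmeas_cond_info. Qed.
Let binfo' : bdmeas info'. Proof. exact: bdmeas_cond_info. Qed.

(** With [y = info - info'], the function [expR (- y)] has mean at most one, so the excess of
    [drop_le] has at most the mean of [y]. *)
Let mean_excess : mean mu (fun x => expR (- (info x - info' x)) - 1 + (info x - info' x))
  <= mean mu info - mean mu info'.
Proof.
have be : bdmeas (fun x => expR (- (info x - info' x))).
  by apply: bdmeas_expR; apply: bdmeasN; exact: bdmeasB.
rewrite meanD; last 2 first.
- by apply: bdmeasB => //; exact: bdmeas_cst.
- exact: bdmeasB.
rewrite (meanB mu be (bdmeas_cst T 1)) (meanB mu binfo binfo') mean_cst gerDr subr_le0.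
by under eq_fun do rewrite opprB; exact: mean_expR_cond_info_diff.
Qed.

Lemma mean_cond_info_le : mean mu info' <= mean mu info.
Proof.
rewrite -subr_ge0; apply: le_trans mean_excess; apply: mean_ge0 => x.
by have := expR_ge1Dx (- (info x - info' x)); lra.
Qed.

Lemma mean_cond_info_drop (z : R) : 0 < z ->
  mean mu (fun x => Num.max 0 (info x - info' x))
    <= z + (mean mu info - mean mu info') / (1 - expR (- z)).
Proof.
move=> z0.
have q0 : 0 < 1 - expR (- z) by rewrite subr_gt0 expR_lt1 oppr_lt0.
have bd : bdmeas (fun x => info x - info' x) by exact: bdmeasB.
have be : bdmeas (fun x => expR (- (info x - info' x)) - 1 + (info x - info' x)).
  apply: bdmeasD => //; apply: bdmeasB; last exact: bdmeas_cst.
  by apply: bdmeas_expR; exact: bdmeasN.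
apply: (@le_trans _ _ (mean mu (fun x => z + (1 - expR (- z))^-1 *
    (expR (- (info x - info' x)) - 1 + (info x - info' x))))).
  apply: mean_le.
  - by apply: bdmeas_max => //; exact: bdmeas_cst.
  - by apply: bdmeasD; [exact: bdmeas_cst|exact: bdmeasZ].
  by move=> x; rewrite (le_trans (drop_le (info x - info' x) z0))// mulrC.
rewrite meanD; [|exact: bdmeas_cst|exact: bdmeasZ].
rewrite mean_cst meanZ// lerD2l mulrC ler_pM2r ?invr_gt0//.
Qed.

End Refine.

(** * Words and the entropy rate *)

Section Words.
Context d (T : measurableType d) (R : realType) (mu : probability T R).
Variable S : T -> T.
Hypothesis mS : measurable_fun setT S.
Hypothesis invS : forall A, measurable A -> mu (S @^-1` A) = mu A.
Variables (I : finType) (N : T -> I).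
Hypothesis mN : finmeas N.

Definition word K x : {ffun 'I_K -> I} := [ffun l : 'I_K => N (iter l S x)].

Lemma wordP K x y :
  word K y = word K x <-> forall l, (l < K)%N -> N (iter l S y) = N (iter l S x).
Proof.
split=> [/ffunP e l lK|e]; first by have := e (Ordinal lK); rewrite !ffunE.
by apply/ffunP => l; rewrite !ffunE e.
Qed.

Lemma finmeas_preimage (W : finType) (V : T -> W) (F : T -> T) :
  measurable_fun setT F -> finmeas V -> finmeas (fun x => V (F x)).
Proof. by move=> mF mV w; rewrite -[X in measurable X]setTI; exact: (mF measurableT _ (mV w)). Qed.

Lemma finmeas_word K : finmeas (word K).
Proof.
move=> w; rewrite (_ : _ @^-1` _ =
    \bigcap_(l in [set: 'I_K]) ((fun x => N (iter l S x)) @^-1` [set w l])).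
  apply: fin_bigcap_measurable => // l _.
  exact: (finmeas_preimage (measurable_iter mS l) mN (w l)).
apply/seteqP; split => [x /= <- l _ /=|x h]; first by rewrite ffunE.
by apply/ffunP => l; rewrite ffunE; exact: h.
Qed.

Lemma finmeas_wordS K : finmeas (fun x => word K (S x)).
Proof. exact: (finmeas_preimage mS (@finmeas_word K)). Qed.

(** This is the [i_K] of the outline: the conditioning is on the names at times [1] to [K]. *)
Definition word_info K := cond_info mu N (fun x => word K (S x)).

Lemma bdmeas_word_info K : bdmeas (word_info K).
Proof. by apply: bdmeas_cond_info => //; exact: finmeas_wordS. Qed.

Definition word_entropy K : R :=
  \sum_(w : {ffun 'I_K -> I}) - (law mu (word K) w * ln (law mu (word K) w)).

Lemma word_entropyE K :
  word_entropy K = - mean mu (fun x => ln (law mu (word K) (word K x))).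
Proof.
rewrite (mean_fin mu (fun w => ln (law mu (word K) w)) (@finmeas_word K)) -sumrN.
by apply: eq_bigr => w _; rewrite mulrC.
Qed.

Lemma law_preimage (W : finType) (V : T -> W) w : finmeas V ->
  law mu (fun x => V (S x)) w = law mu V w.
Proof. by move=> mV; rewrite /law; congr fine; apply: invS; exact: mV. Qed.

(** Chain rule: the name of [x] together with the word of [S x] has the cells of the longer word,
    and by invariance the word of [S x] has the law of the word of [x]. *)
Lemma mean_word_info K : mean mu (word_info K) = word_entropy K.+1 - word_entropy K.
Proof.
rewrite !word_entropyE /word_info /cond_info.
pose P K x := ln (law mu (word K) (word K x)).
have bP K' : bdmeas (P K').
  exact: (bdmeas_fin (fun w => ln (law mu (word K') w)) (@finmeas_word K')).
rewrite (_ : (fun x => _) = (fun x => P K (S x) - P K.+1 x)); last first.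
  apply/funext => x; rewrite /P law_preimage; last exact: finmeas_word.
  congr (_ - ln _).
  apply: (@law_fibre _ _ _ mu _ _ (fun y => (N y, word K (S y)))) => y; rewrite wordP.
  split=> [[e0 /wordP e] [|l] //|e]; first by rewrite ltnS !iterSr; exact: e.
  congr (_, _); first exact: (e 0%N).
  by apply/wordP => l lK; rewrite -!iterSr; exact: e.
rewrite meanB//; last by apply: bdmeas_comp.
by rewrite mean_comp// opprK addrC.
Qed.

Lemma word_entropy0 : word_entropy 0 = 0.
Proof.
rewrite word_entropyE (_ : (fun x => _) = cst 0) ?mean_cst ?oppr0//.
apply/funext => x /=; rewrite /law (_ : _ @^-1` _ = setT).
  by rewrite probability_setT ln1.
by apply/seteqP; split => y //= _; apply/wordP.
Qed.

Lemma word_entropy_sum n : word_entropy n = \sum_(0 <= K < n) mean mu (word_info K).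
Proof.
under eq_bigr do rewrite mean_word_info.
by rewrite telescope_sumr// word_entropy0 subr0.
Qed.

Lemma word_restrict K K' : (K <= K')%N -> exists r : {ffun 'I_K' -> I} -> {ffun 'I_K -> I},
  forall x, word K x = r (word K' x).
Proof.
move=> KK'; exists (fun w => [ffun l : 'I_K => w (widen_ord KK' l)]) => y.
by apply/ffunP => l; rewrite !ffunE.
Qed.

Lemma word_info_mono K K' : (K <= K')%N -> mean mu (word_info K') <= mean mu (word_info K).
Proof.
move=> KK'; have [r rE] := word_restrict KK'.
exact: (mean_cond_info_le mu mN (@finmeas_wordS K') (fun x => rE (S x))).
Qed.

Lemma word_info_drop K K' (z : R) : (K <= K')%N -> 0 < z ->
  mean mu (fun x => Num.max 0 (word_info K x - word_info K' x))
    <= z + (mean mu (word_info K) - mean mu (word_info K')) / (1 - expR (- z)).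
Proof.
move=> KK' z0; have [r rE] := word_restrict KK'.
exact: (mean_cond_info_drop mu mN (@finmeas_wordS K') (fun x => rE (S x)) z0).
Qed.

Definition entropy_rate := limn (fun n => mean mu (word_info n)).

Lemma word_info_cvg : (fun n => mean mu (word_info n)) @ \oo --> entropy_rate.
Proof.
apply: nonincreasing_is_cvgn => [m n|]; first exact: word_info_mono.
exists 0 => _ [n _ <-]; apply: mean_cond_info_ge0 => //; exact: finmeas_wordS.
Qed.

Lemma word_info_ge_rate n : entropy_rate <= mean mu (word_info n).
Proof.
apply: cvgr_to_le word_info_cvg _; exists n => // m /= nm; exact: word_info_mono.
Qed.

(** The quotients are Cesaro means of the conditional entropies, which converge to the rate. *)
Lemma word_entropy_cvg : (fun n => n%:R^-1 * word_entropy n) @ \oo --> entropy_rate.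
Proof.
rewrite -cvg_shiftS; have := cesaro word_info_cvg.
rewrite /arithmetic_mean/= /series/=; under eq_fun do rewrite -word_entropy_sum.
by [].
Qed.

(** The infimum of the truncated informations over sparse horizons [K r]: the running minimum loses
    at most [e] in the mean, and the infimum lies below the information at arbitrarily large
    horizons, as every depth of the chain argument requires. *)
Theorem info_function (e : R) : 0 < e -> exists g : T -> R,
  [/\ bdmeas g, forall x, 0 <= g x, entropy_rate - e <= mean mu g &
      forall n, exists2 K, (n <= K)%N & forall x, g x <= Num.max 0 (word_info K x)].
Proof.
(* The step from [K r] to [K r.+1] will cost at most [2 * z r = e / 2 ^+ r.+1] in the mean, and
   these costs sum to [e]. *)
move=> e0; pose z r : R := e / 2 ^+ r.+2.
have z0 r : 0 < z r by rewrite divr_gt0// exprn_gt0.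
have q0 r : 0 < 1 - expR (- z r) by rewrite subr_gt0 expR_lt1 oppr_lt0.
(* The factor [1 - expR (- z r)] cancels the denominator in [word_info_drop]. *)
have /choice [kap kapP] : forall r, exists K0, forall K, (K0 <= K)%N ->
    mean mu (word_info K) - entropy_rate <= z r * (1 - expR (- z r)).
  move=> r; have : \forall n \near \oo,
      mean mu (word_info n) < entropy_rate + z r * (1 - expR (- z r)).
    by apply: cvgr_lt word_info_cvg _ _; rewrite ltrDl mulr_gt0.
  by move=> [K0 _ h]; exists K0 => K /h /= /ltW; rewrite -lerBlDl.
pose fix K r := if r is r'.+1 then maxn (kap r) (K r').+1 else kap 0%N.
have Kkap r : (kap r <= K r)%N by case: r => [|r] //=; rewrite leq_maxl.
have Klt r : (K r < K r.+1)%N by rewrite /= leq_maxr.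
have Kge r : (r <= K r)%N by elim: r => // r /leq_ltn_trans; apply.
pose i r x := Num.max 0 (word_info (K r) x).
have bi r : bdmeas (i r).
  by apply: bdmeas_max; [exact: bdmeas_cst|exact: bdmeas_word_info].
pose fix g r := if r is r'.+1 then (fun x => Num.min (g r' x) (i r x)) else i 0%N.
have bg r : bdmeas (g r) by elim: r => //= r IH; exact: bdmeas_min.
have gi r x : g r x <= i r x by case: r => //= r; rewrite ge_min lexx orbT.
have g0 r x : 0 <= g r x.
  by elim: r => [|r IH] /=; rewrite ?le_min ?IH /i le_max lexx.
have g_dec x : nonincreasing_seq (g ^~ x).
  by apply/nonincreasing_seqP => r /=; rewrite ge_min lexx.
(* The term [e / 2 ^+ r] is the part of the allowed loss [e] not yet spent. *)
have mean_g r : entropy_rate - e + e / 2 ^+ r <= mean mu (g r).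
  elim: r => [|r IH].
    rewrite expr0 divr1 subrK (le_trans (word_info_ge_rate (K 0%N)))//.
    apply: mean_le; [exact: bdmeas_word_info|exact: bi|move=> x].
    by rewrite le_max lexx orbT.
  pose dr x := Num.max 0 (word_info (K r) x - word_info (K r.+1) x).
  have bdr : bdmeas dr.
    apply: bdmeas_max; first exact: bdmeas_cst.
    by apply: bdmeasB; exact: bdmeas_word_info.
  have drop : mean mu dr <= z r + z r.
    apply: (le_trans (word_info_drop (ltnW (Klt r)) (z0 r))).
    rewrite lerD2l ler_pdivrMr//; apply: le_trans (kapP r _ (Kkap r)).
    by rewrite lerD2l lerN2; exact: word_info_ge_rate.
  have step : mean mu (g r) - mean mu dr <= mean mu (g r.+1).
    rewrite -meanB//; apply: mean_le => //; first exact: bdmeasB.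
    move=> x /=; rewrite le_min; apply/andP; split.
      by rewrite gerBl le_max lexx.
    have := gi r x; rewrite /i /dr.
    have [a|a] := leP 0 (word_info (K r) x);
    have [b|b] := leP 0 (word_info (K r.+1) x);
    have [c|c] := leP 0 (word_info (K r) x - word_info (K r.+1) x); lra.
  have zz : z r + z r = e / 2 ^+ r - e / 2 ^+ r.+1.
    rewrite /z !exprS; field; exact: expf_neq0.
  lra.
pose G x := limn (g ^~ x).
have gG x : g ^~ x @ \oo --> G x.
  by apply: nonincreasing_is_cvgn => //; exists 0 => _ [r _ <-].
have [M iM] := (bi 0%N).2.
have gM r x : `|g r x| <= M.
  rewrite ger0_norm//; apply: le_trans (iM x); rewrite ger0_norm.
    exact: (g_dec x 0%N r).
  exact: (g0 0%N).
have [bG mG] := mean_cvg mu (fun r => (bg r).1) gM gG.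
have Gg r x : G x <= g r x.
  by apply: cvgr_to_le (gG x) _; exists r => // m /= rm; exact: g_dec.
exists G; split=> //.
- by move=> x; apply: cvgr_to_ge (gG x) _; apply: nearW => r.
- apply: cvgr_to_ge mG _; apply: nearW => r; apply: le_trans (mean_g r).
  by rewrite lerDl divr_ge0// ?ltW// exprn_ge0.
- by move=> n; exists (K n) => // x; exact: le_trans (Gg n x) (gi n x).
Qed.

End Words.

(** * Sums weighted over several levels *)

Section Chain.
Context d (T : measurableType d) (R : realType) (mu : probability T R).
Variable S : T -> T.
Hypothesis mS : measurable_fun setT S.
Hypothesis invS : forall A, measurable A -> mu (S @^-1` A) = mu A.
Variables (I : finType) (C : R).

(** Induction on [L], peeling off time [0]. The later factors are majorized by a function of a word
    of [S x] of some length [K']; as [g 0] is below the information given [K >= K'] later names, the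
    factor at time [0] integrates to at most [C] given that word. The majorant must depend on a
    finite word only, so that the next step can condition on it. *)
Lemma chain_majorant (L : nat) (N : nat -> T -> I) (r : nat -> I -> I)
    (g : nat -> T -> R) (c : nat -> I -> R) :
  (forall l, finmeas (N l)) ->
  (forall l x, N l.+1 x = r l (N l x)) ->
  (forall l n, exists2 K, (n <= K)%N &
     forall x, g l x <= Num.max 0 (word_info mu S (N l) K x)) ->
  (forall l i, 0 <= c l i) -> (forall l, \sum_i c l i <= C) ->
  exists K (F : {ffun 'I_K -> I} -> R), [/\ forall w, 0 <= F w,
    mean mu (fun x => F (word S (N 0%N) K x)) <= C ^+ L &
    forall x, \prod_(l < L) (c l (N l (iter l S x)) * expR (g l (iter l S x)))
      <= F (word S (N 0%N) K x)].
Proof.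
elim: L N r g c => [|L IH] N r g c mN Nr gK c0 cC.
  exists 0%N, (fun=> 1); split=> // [|x]; last by rewrite big_ord0.
  by rewrite expr0 (mean_cst mu 1).
have [K' [F' [F'0 mF' F'le]]] := IH (fun l => N l.+1) (fun l => r l.+1)
  (fun l => g l.+1) (fun l => c l.+1) (fun l => mN l.+1) (fun l => Nr l.+1)
  (fun l => gK l.+1) (fun l => c0 l.+1) (fun l => cC l.+1).
have [K KK' gKx] := gK 0%N K'.
pose V x := word S (N 0%N) K (S x).
have mV : finmeas V := @finmeas_wordS _ _ S mS _ _ (mN 0%N) K.
(* Since [N 1] is a function of [N 0] and [K' <= K], the shorter word for [N 1] can be read off the
   longer word for [N 0]. *)
pose q (w : {ffun 'I_K -> I}) : {ffun 'I_K' -> I} :=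
  [ffun l => r 0%N (w (widen_ord KK' l))].
have qE x : word S (N 1%N) K' x = q (word S (N 0%N) K x).
  by apply/ffunP => l; rewrite !ffunE Nr.
pose tl (w : {ffun 'I_K.+1 -> I}) : {ffun 'I_K -> I} := [ffun l => w (lift ord0 l)].
have tlE x : tl (word S (N 0%N) K.+1 x) = V x.
  by apply/ffunP => l; rewrite !ffunE -iterSr.
pose ci (w : {ffun 'I_K.+1 -> I}) : R := ln (law mu V (tl w)) -
  ln (law mu (fun y => (N 0%N y, V y)) (w ord0, tl w)).
have ciE x : ci (word S (N 0%N) K.+1 x) = word_info mu S (N 0%N) K x.
  by rewrite /ci tlE ffunE.
exists K.+1, (fun w : {ffun 'I_K.+1 -> I} =>
  c 0%N (w ord0) * F' (q (tl w)) * expR (Num.max 0 (ci w))).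
split=> [w||x].
- by rewrite !mulr_ge0 ?expR_ge0.
- under eq_fun => x do rewrite ciE tlE ffunE.
  apply: (le_trans (mean_expR_cond_info mu (F := fun i w => c 0%N i * F' (q w))
    (mN 0%N) mV (fun i w => mulr_ge0 (c0 0%N i) (F'0 (q w))))).
  have bF' : bdmeas (fun x => F' (q (V x))) := bdmeas_fin (fun w => F' (q w)) mV.
  apply: (@le_trans _ _ (mean mu (fun x => C * F' (q (V x))))).
    apply: mean_le; last by move=> x; rewrite -mulr_suml ler_wpM2r.
    - by apply: bdmeas_sum => i _; exact: bdmeasZ.
    - exact: bdmeasZ.
  have C0 : 0 <= C by apply: le_trans (cC 0%N); apply: sumr_ge0.
  rewrite meanZ// exprS ler_wpM2l//; apply: le_trans mF'.
  under eq_fun => x do rewrite /V -qE.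
  rewrite (mean_comp mS invS (f := fun x => F' (word S (N 1%N) K' x)))//.
  by apply: (bdmeas_fin F'); apply: (finmeas_word mS).
- rewrite big_ord_recl/= ffunE [leRHS]mulrAC; apply: ler_pM.
  + by rewrite mulr_ge0 ?expR_ge0.
  + by apply: prodr_ge0 => l _; rewrite mulr_ge0 ?expR_ge0.
  + by rewrite ler_wpM2l// ler_expR ciE.
  + rewrite tlE -qE; apply: le_trans (F'le (S x)).
    by under eq_bigr do rewrite -iterS iterSr.
Qed.

Lemma chain_mean_le (L : nat) (N : nat -> T -> I) (r : nat -> I -> I)
    (g : nat -> T -> R) (c : nat -> I -> R) :
  (forall l, finmeas (N l)) -> (forall l, bdmeas (g l)) ->
  (forall l x, N l.+1 x = r l (N l x)) ->
  (forall l n, exists2 K, (n <= K)%N &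
     forall x, g l x <= Num.max 0 (word_info mu S (N l) K x)) ->
  (forall l i, 0 <= c l i) -> (forall l, \sum_i c l i <= C) ->
  mean mu (fun x => \prod_(l < L) (c l (N l (iter l S x)) * expR (g l (iter l S x))))
    <= C ^+ L.
Proof.
move=> mN bg Nr gK c0 cC.
have [K [F [F0 mF Fle]]] := chain_majorant L mN Nr gK c0 cC.
apply: le_trans mF; apply: mean_le => //.
  apply: bdmeas_prod => l _; have mi := measurable_iter mS l.
  apply: bdmeasM; first exact: (bdmeas_comp mi (bdmeas_fin (c l) (mN l))).
  exact: (bdmeas_comp mi (bdmeas_expR (bg l))).
by apply: (bdmeas_fin F); exact: (finmeas_word mS).
Qed.

End Chain.

Lemma nceil_itv (R : realType) (x : R) : 0 <= x -> x <= (nceil x)%:R < x + 1.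
Proof.
move=> x0; rewrite /nceil.
have c0 : 0 <= Num.ceil x by rewrite ceil_ge0 (lt_le_trans _ x0)// ltrN10.
rewrite -[(_ : nat)%:R]mulrz_nat natz gez0_abs//.
have := ceilB1_lt x; rewrite intrB mulr1z => h.
by apply/andP; split; [exact: ceil_ge|lra].
Qed.

(** * The levels of a weighted join along the time axis *)

Section Levels.
Variables (k : nat) (t : nat -> nat).
Hypothesis t_nd : forall i j, (i <= j)%N -> (j < k)%N -> (t i <= t j)%N.

(** For nondecreasing thresholds, the covers of index at least [level l] are those that still
    constrain the orbit at time [l]. *)
Definition level l := (\sum_(i < k) (t i <= l))%N.

Lemma level_nd l : (level l <= level l.+1)%N.
Proof. by apply: leq_sum => i _; case: (leqP (t i) l) => // /leqW ->. Qed.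

Let sum_ltn j : (j <= k)%N -> (\sum_(i < k) (i < j) = j)%N.
Proof.
move=> jk; rewrite -[RHS]card_ord -sum1_card (big_ord_widen k (fun=> 1%N) jk).
by rewrite [RHS]big_mkcond; apply: eq_bigr => i _; case: (_ < _)%N.
Qed.

Lemma level_lt l j : (j < k)%N -> (level l <= j)%N -> (l < t j)%N.
Proof.
move=> jk; apply: contraTT; rewrite -leqNgt -ltnNge => tl.
rewrite -[leqLHS](sum_ltn jk); apply: leq_sum => i _.
by case: (ltnP i j.+1) => //; rewrite ltnS => ij; rewrite (leq_trans (t_nd ij jk) tl).
Qed.

Lemma level_eq l i : (i < k)%N -> (forall j, (j < i)%N -> (t j <= l)%N) ->
  (l < t i)%N -> level l = i.
Proof.
move=> ik lo hi; rewrite -[RHS](sum_ltn (ltnW ik)); apply: eq_bigr => j _.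
case: (ltnP j i) => [/lo ->//|ij]; congr nat_of_bool; apply/negbTE.
by rewrite -ltnNge (leq_trans hi)// t_nd.
Qed.

Definition prev_threshold i := if i is i'.+1 then t i' else 0%N.

(** Time is cut into the blocks between consecutive thresholds, on each of which the level is
    constant. *)
Lemma level_sum (R : realType) (F : nat -> nat -> R) j : (j < k)%N ->
  \sum_(0 <= l < t j) F (level l) l =
  \sum_(0 <= i < j.+1) \sum_(prev_threshold i <= l < t i) F i l.
Proof.
elim: j => [|j IH] jk.
  rewrite big_nat1; apply: eq_big_nat => l /andP[_ l0].
  by rewrite (@level_eq l 0).
rewrite [RHS]big_nat_recr//= -IH; last exact: ltnW.
rewrite (big_cat_nat (n := t j))//=; last exact: t_nd.
congr (_ + _); apply: eq_big_nat => l /andP[jl lj].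
rewrite (@level_eq l j.+1)// => i ij; apply: leq_trans jl.
by apply: t_nd => //; exact: ltnW.
Qed.

End Levels.

Section AlmostEverywhere.
Context d (T : measurableType d) (R : realType) (mu : probability T R).

Lemma ae_forall_ltn (P : nat -> T -> Prop) k :
  (forall i, {ae mu, forall x, P i x}) ->
  {ae mu, forall x, forall i, (i < k)%N -> P i x}.
Proof.
move=> aeP; elim: k => [|k IH]; first exact: aeW.
apply: filterS2 IH (aeP k) => x Px Pk i; rewrite ltnS leq_eqVlt.
by case/predU1P => [->|/Px].
Qed.

Lemma mean_le_ae f g : bdmeas f -> bdmeas g ->
  {ae mu, forall x, f x <= g x} -> mean mu f <= mean mu g.
Proof.
move=> bf bg fg; have bm := bdmeas_min bf bg.
have -> : mean mu f = mean mu (fun x => Num.min (f x) (g x)).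
  congr fine; apply: ae_eq_integral => //.
  - exact/measurable_EFinP/bf.1.
  - exact/measurable_EFinP/bm.1.
  - by apply: filterS fg => x fg _; rewrite (min_idPl fg).
by apply: mean_le => // x; rewrite ge_min lexx orbT.
Qed.

Lemma measurable_le (f g : T -> R) : bdmeas f -> bdmeas g ->
  measurable [set x | f x <= g x].
Proof.
move=> bf bg; rewrite (_ : [set x | _] = ~` [set x | g x < f x]).
  by apply: measurableC; exact: measurable_lt.
by apply/seteqP; split => x /=; rewrite leNgt => /negP.
Qed.

(** If all these sets were null, almost every point would have a limit at most [c], and so the mean
    of [F] would be at most [c]. *)
Lemma eventually_pos (u : nat -> T -> R) (F : T -> R) (c : R) :
  (forall n, bdmeas (u n)) -> bdmeas F ->
  {ae mu, forall x, u ^~ x @ \oo --> F x} -> c < mean mu F ->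
  exists M, measurable (\bigcap_(n in [set n | (M <= n)%N]) [set x | c <= u n x]) /\
   0 < fine (mu (\bigcap_(n in [set n | (M <= n)%N]) [set x | c <= u n x])).
Proof.
move=> bu bF uF cF.
pose G M := \bigcap_(n in [set n | (M <= n)%N]) [set x | c <= u n x].
have mG M : measurable (G M).
  apply: bigcap_measurableType => n _; apply: measurable_le => //.
  exact: bdmeas_cst.
suff : ~ forall M, fine (mu (G M)) <= 0.
  move=> /existsNP[M /negP]; rewrite -ltNge => GM; exists M; split=> //; exact: mG.
move=> G0; have nG : mu.-negligible (\bigcup_M G M).
  apply: negligible_bigcup => M; apply/negligibleP; first exact: mG.
  rewrite -[LHS]fineK; last by rewrite fin_num_measure.
  by congr EFin; apply/eqP; rewrite eq_le G0 fine_ge0.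
move: cF; apply/negP; rewrite -leNgt -[leRHS](mean_cst mu c).
apply: mean_le_ae => //; first exact: bdmeas_cst.
have nG' : {ae mu, forall x, ~ (\bigcup_M G M) x}.
  by apply: negligibleS nG => x /= /contrapT.
apply: filterS2 uF nG' => x ux xG; rewrite leNgt; apply/negP => cFx; apply: xG.
have [M _ hM] : \forall n \near \oo, c < u n x by apply: cvgr_gt ux _ _.
by exists M => // n /= Mn; exact/ltW/hM.
Qed.

End AlmostEverywhere.

Lemma cvg_nceil (R : realType) (c : R) : 0 <= c ->
  (fun n : nat => n%:R^-1 * (nceil (c * n%:R))%:R) @ \oo --> c.
Proof.
move=> c0; apply/cvgrPdist_le => e e0; near=> n.
have n0 : 0 < n%:R :> R by rewrite ltr0n; near: n; exists 1%N.
have /andP[a b] := nceil_itv (mulr_ge0 c0 (ltW n0)).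
rewrite distrC ger0_norm; last by rewrite subr_ge0 ler_pdivlMl// mulrC.
rewrite lerBlDr ler_pdivrMl// (le_trans (ltW b))//.
rewrite mulrDr [_ * c]mulrC addrC lerD2r.
rewrite -ler_pdivrMr// div1r.
near: n; exact: nbhs_infty_ger.
Unshelve. all: by end_near. Qed.

Lemma nceil_ge (R : realType) (c : R) M : 0 < c ->
  \forall n \near \oo, (M <= nceil (c * n%:R))%N.
Proof.
move=> c0; near=> n.
have /andP[a _] := nceil_itv (mulr_ge0 (ltW c0) (ler0n R n)).
rewrite -(ler_nat R); apply: le_trans a; rewrite -ler_pdivrMl//.
near: n; exact: nbhs_infty_ger.
Unshelve. all: by end_near. Qed.

(** * Birkhoff sums of an observable that changes with the level *)

Section WeightedSums.
Context d (T : measurableType d) (R : realType).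
Variables (S : T -> T) (k : nat) (a : nat -> R).
Hypotheses (k0 : (0 < k)%N) (a0 : 0 < a 0%N).
Hypothesis a_ge0 : forall i, (i < k)%N -> 0 <= a i.

Definition csum i := \sum_(j < i.+1) a j.

Definition threshold n i := nceil (csum i * n%:R).

Lemma csum_gt0 i : (i < k)%N -> 0 < csum i.
Proof.
move=> ik; rewrite /csum big_ord_recl ltr_pwDl//; apply: sumr_ge0 => j _.
by apply: a_ge0; rewrite (leq_ltn_trans _ ik)//; case: j.
Qed.

Lemma csumS i : csum i.+1 = csum i + a i.+1.
Proof. by rewrite /csum big_ord_recr. Qed.

Lemma threshold_nd n i j : (i <= j)%N -> (j < k)%N -> (threshold n i <= threshold n j)%N.
Proof.
move=> ij jk.
have cij : csum i <= csum j.
  elim: j ij jk => [|j IH]; first by rewrite leqn0 => /eqP ->.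
  rewrite leq_eqVlt => /predU1P[->//|ij jk].
  by rewrite csumS (le_trans (IH ij (ltnW jk)))// lerDl a_ge0.
have ci := ltW (csum_gt0 (leq_ltn_trans ij jk)).
have h : Num.ceil (csum i * n%:R) <= Num.ceil (csum j * n%:R).
  by apply: le_ceil; rewrite ler_wpM2r.
rewrite /threshold /nceil -lez_nat !gez0_abs//.
  by rewrite ceil_ge0 (lt_le_trans (ltrN10 _))// mulr_ge0// (le_trans ci).
by rewrite ceil_ge0 (lt_le_trans (ltrN10 _))// mulr_ge0.
Qed.

Lemma birkhoff_sum_threshold (phi : T -> R) (F : R) x i : (i < k)%N ->
  birkhoff_mean S phi ^~ x @ \oo --> F ->
  (fun n => n%:R^-1 * birkhoff_sum S phi (threshold n i) x) @ \oo --> csum i * F.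
Proof.
move=> ik bF.
have -> : (fun n => n%:R^-1 * birkhoff_sum S phi (threshold n i) x) =
    (fun n => (n%:R^-1 * (threshold n i)%:R) * birkhoff_mean S phi (threshold n i) x).
  apply/funext => n; rewrite /birkhoff_mean.
  have [->|t0] := eqVneq (threshold n i) 0%N.
    by rewrite /birkhoff_sum big_ord0 !mulr0.
  by rewrite -mulrA mulVKf// pnatr_eq0.
apply: cvgM; first exact: cvg_nceil (ltW (csum_gt0 ik)).
apply: (cvg_comp (fun n => threshold n i)) bF => A [M _ MA].
have [M' _ h] := nceil_ge M (csum_gt0 ik).
by exists M' => // n /h /MA.
Qed.

Variable phi : nat -> T -> R.

Definition weighted_sum n x : R :=
  \sum_(0 <= l < threshold n k.-1) phi (level k (threshold n) l) (iter l S x).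

Lemma weighted_sumE n x : weighted_sum n x = \sum_(0 <= i < k)
  (birkhoff_sum S (phi i) (threshold n i) x -
   birkhoff_sum S (phi i) (prev_threshold (threshold n) i) x).
Proof.
rewrite /weighted_sum (level_sum (threshold_nd n) (fun i l => phi i (iter l S x)));
  last by rewrite prednK.
rewrite prednK//; apply: eq_big_nat => i /andP[_ ik].
rewrite /birkhoff_sum -!(big_mkord xpredT (fun l => phi i (iter l S x))).
apply/eqP; rewrite eq_sym subr_eq addrC -big_cat_nat//=.
by case: i ik => //= i ik; apply: threshold_nd.
Qed.

(** Level [i] occupies about [a i * n] times, between two consecutive thresholds; its share is a
    difference of two Birkhoff sums started at time [0]. *)
Lemma weighted_sum_cvg (F : nat -> R) x :
  (forall i, (i < k)%N -> birkhoff_mean S (phi i) ^~ x @ \oo --> F i) ->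
  (fun n => n%:R^-1 * weighted_sum n x) @ \oo --> \sum_(0 <= i < k) a i * F i.
Proof.
move=> bF; rewrite big_nat.
have -> : (fun n => n%:R^-1 * weighted_sum n x) =
    (fun n => \sum_(0 <= i < k | (0 <= i < k)%N) n%:R^-1 *
      (birkhoff_sum S (phi i) (threshold n i) x -
       birkhoff_sum S (phi i) (prev_threshold (threshold n) i) x)).
  by apply/funext => n; rewrite weighted_sumE mulr_sumr big_nat.
apply: cvg_big => [|i /andP[_ ik]]; first exact: add_continuous.
under eq_fun do rewrite mulrBr.
case: i ik => [|i] ik /=.
  have -> : a 0%N * F 0%N = csum 0 * F 0%N - 0.
    by rewrite subr0 /csum big_ord_recl big_ord0 addr0.
  apply: cvgB; first exact: birkhoff_sum_threshold (bF _ ik).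
  by under eq_fun do rewrite /birkhoff_sum big_ord0 mulr0; exact: cvg_cst.
have -> : a i.+1 * F i.+1 = csum i.+1 * F i.+1 - csum i * F i.+1.
  by rewrite csumS; ring.
by apply: cvgB; apply: birkhoff_sum_threshold (bF _ ik) => //; exact: ltnW.
Qed.

End WeightedSums.

(** * The mass of the cells of a weighted join *)

Section WeightedMass.
Context d (T : measurableType d) (R : realType) (mu : probability T R).
Variable S : T -> T.
Hypothesis mS : measurable_fun setT S.
Hypothesis invS : forall A, measurable A -> mu (S @^-1` A) = mu A.
Variables (I : finType) (k : nat) (a : nat -> R).
Hypotheses (k0 : (0 < k)%N) (a0 : 0 < a 0%N).
Hypothesis a_ge0 : forall i, (i < k)%N -> 0 <= a i.
Variables (N : nat -> T -> I) (r : nat -> nat -> I -> I).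
Hypothesis mN : forall i, finmeas (N i).
Hypothesis Nr : forall i j x, (i <= j)%N -> N j x = r i j (N i x).
Variables (f : T -> R) (bf : bdmeas f).

Let t := threshold a.
Let lev n := level k (t n).
Let L n := t n k.-1.

Let H : R := \sum_(0 <= i < k) a i * entropy_rate mu S (N i) + mean mu f.

(** A Markov inequality for the product in [chain_mean_le], with weights that penalize every letter
    other than the expected [b l]. The mean is at most [C ^+ L n], and [1 + t <= expR t] turns this
    into the last error term. *)
Lemma mass_bound (g : nat -> T -> R) (theta delta h : R) V A n (b : nat -> I) sigma G :
  (forall i, bdmeas (g i)) ->
  (forall i n, exists2 K, (n <= K)%N &
     forall x, g i x <= Num.max 0 (word_info mu S (N i) K x)) ->
  0 <= theta -> measurable A -> measurable G ->
  (forall x, A x -> forall l, (l < L n)%N ->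
     N (lev n l) (iter l S x) <> b l -> V (iter l S x)) ->
  (forall x, A x -> birkhoff_sum S f (t n 0%N) x <= sigma) ->
  (forall x, G x -> ~ often_in S V delta x) ->
  (forall x, G x -> h <= (a 0%N)^-1 * birkhoff_sum S f (t n 0%N) x +
     \sum_(0 <= l < L n) g (lev n l) (iter l S x)) ->
  fine (mu (A `&` G)) <= expR (- h + (a 0%N)^-1 * sigma +
     (L n)%:R * (theta * delta + #|I|%:R * expR (- theta))).
Proof.
move=> bg gK th0 mA mG AV Asig GV Gh.
pose c l i : R := if i == b l then 1 else expR (- theta).
have c0 l i : 0 <= c l i by rewrite /c; case: ifP => // _; exact: expR_ge0.
pose C : R := 1 + #|I|%:R * expR (- theta).
have cC l : \sum_i c l i <= C.
  rewrite (bigD1 (b l))//= {1}/c eqxx lerD2l.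
  apply: (@le_trans _ _ (\sum_(i in I) expR (- theta))).
    rewrite big_mkcond/=; apply: ler_sum => i _.
    by rewrite /c; case: eqP => _ //=; exact: expR_ge0.
  by rewrite sumr_const mulr_natl.
have mprod := @chain_mean_le _ _ _ mu S mS invS I C (L n) (fun l => N (lev n l))
  (fun l => r (lev n l) (lev n l.+1)) (fun l => g (lev n l)) c
  (fun l => @mN (lev n l)) (fun l => bg (lev n l))
  (fun l x => Nr x (level_nd k (t n) l)) (fun l => gK (lev n l)) c0 cC.
(* The product is at least [kappa] on the intersection of [A] and [G]: at most [delta * L n] letters
   are wrong there, and the sum of the [g] is at least [h] minus the contribution of [f]. *)
pose kappa := expR (h - (a 0%N)^-1 * sigma - theta * (delta * (L n)%:R)).
have mAG : measurable (A `&` G) by exact: measurableI.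
have le1 : kappa * fine (mu (A `&` G)) <= C ^+ L n.
  rewrite -mean_indic// -meanZ; last exact: bdmeas_indic.
  apply: le_trans mprod; apply: mean_le.
  - by apply: bdmeasZ; exact: bdmeas_indic.
  - apply: bdmeas_prod => l _; have mi := measurable_iter mS l.
    apply: bdmeasM; first exact: (bdmeas_comp mi (bdmeas_fin (c l) (@mN (lev n l)))).
    exact: (bdmeas_comp mi (bdmeas_expR (bg (lev n l)))).
  move=> x; rewrite indicE; have [/set_mem[Ax Gx]|_] := boolP (x \in A `&` G); last first.
    by rewrite mulr0; apply: prodr_ge0 => l _; rewrite mulr_ge0 ?expR_ge0.
  rewrite mulr1 big_split/= -expR_sum.
  have sV : birkhoff_sum S \1_V (L n) x <= delta * (L n)%:R.
    by rewrite leNgt; apply/negP => lt; apply: (GV _ Gx); exists (L n).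
  have pc : expR (- theta * (delta * (L n)%:R)) <= \prod_(l < L n) c l (N (lev n l) (iter l S x)).
    apply: (@le_trans _ _ (\prod_(l < L n) expR (- theta * \1_V (iter l S x)))).
      rewrite -expR_sum ler_expR -mulr_sumr !mulNr lerN2 ler_wpM2l//.
    apply: ler_prod => l _; rewrite expR_ge0/= /c; case: eqP => [_|/AV Vx].
      by rewrite expR_le1 mulNr oppr_le0 mulr_ge0// indicE; case: (_ \in _).
    by rewrite indicE mem_set ?mulr1//; exact: Vx.
  rewrite /kappa expRD mulrC -mulNr; apply: ler_pM => //; try exact: expR_ge0.
  rewrite ler_expR -(big_mkord xpredT (fun l => g (lev n l) (iter l S x))).
  have := Gh _ Gx; have : (a 0%N)^-1 * birkhoff_sum S f (t n 0) x <= (a 0%N)^-1 * sigma.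
    by rewrite ler_wpM2l ?invr_ge0 ?(ltW a0)//; exact: Asig.
  lra.
have CL : C ^+ L n <= expR ((L n)%:R * (#|I|%:R * expR (- theta))).
  rewrite expRM_natl; apply: lerXn2r; rewrite ?nnegrE ?expR_ge0//.
    by rewrite addr_ge0// mulr_ge0 ?expR_ge0.
  exact: expR_ge1Dx.
rewrite -ler_pdivlMl ?expR_gt0// in le1.
apply: (le_trans le1); rewrite /kappa -expRN.
apply: (le_trans (ler_wpM2l (expR_ge0 _) CL)).
rewrite -expRD ler_expR; lra.
Qed.

(** The set [G1] collects the points whose weighted averages are large from a common time on. It is
    found before [V], so that [eta] can be chosen to keep positive measure when the points visiting
    [V] too often are removed. *)
Theorem weighted_mass (eps : R) : 0 < eps ->
  exists2 eta : R, 0 < eta & forall V, measurable V -> fine (mu V) < eta ->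
  exists G M, [/\ measurable G, 0 < fine (mu G) &
    forall n, (M <= n)%N -> forall (b : nat -> I) A sigma, measurable A ->
      (forall x, A x -> forall l, (l < L n)%N ->
         N (lev n l) (iter l S x) <> b l -> V (iter l S x)) ->
      (forall x, A x -> birkhoff_sum S f (t n 0%N) x <= sigma) ->
      fine (mu (A `&` G)) <=
        expR (- (H - eps) * n%:R + (a 0%N)^-1 * sigma)].
Proof.
move=> eps0.
pose ck := csum a k.-1.
have k1k : (k.-1 < k)%N by rewrite prednK.
have ck0 : 0 < ck by exact: csum_gt0 a0 a_ge0 _ k1k.
have asum : \sum_(0 <= i < k) a i = ck by rewrite /ck /csum prednK// big_mkord.
have e40 : 0 < eps / 4 by rewrite divr_gt0.
(* The explicit choice rests on [expR (- theta) <= theta^-1]. As [L n <= (ck + 1) * n] for [n >= 1],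
   this error costs at most [eps / 4] per unit of [n]. *)
have [theta th0 thI] : exists2 theta : R, 0 < theta &
    #|I|%:R * expR (- theta) <= eps / 4 / (ck + 1).
  have q0 : 0 < eps / 4 / (ck + 1) by rewrite divr_gt0// addr_gt0.
  have th0 : 0 < (#|I|%:R + 1) / (eps / 4 / (ck + 1)).
    by rewrite divr_gt0// ltr_wpDl.
  exists ((#|I|%:R + 1) / (eps / 4 / (ck + 1))) => //.
  set th := (_ / _) in th0 *.
  have le1 : expR (- th) <= th^-1.
    rewrite expRN lef_pV2 ?posrE ?expR_gt0//.
    by apply: le_trans (expR_ge1Dx th); rewrite lerDr.
  apply: (le_trans (ler_wpM2l _ le1)) => //.
  rewrite ler_pdivrMr// /th mulrC divfK ?gt_eqF//.
  by rewrite lerDl.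
(* Makes [theta * delta] equal to the bound just used, so that the penalty costs another [eps / 4]
   per unit of [n]. *)
pose delta := eps / 4 / (ck + 1) / theta.
have delta0 : 0 < delta by rewrite !divr_gt0// addr_gt0.
(* The weights [a i] add up to [ck], so losing [e1] at every level costs [eps / 4] in all. *)
pose e1 := eps / 4 / ck.
have e10 : 0 < e1 by rewrite divr_gt0.
have /choice [g gP] : forall i, exists g : T -> R,
    [/\ bdmeas g, forall x, 0 <= g x, entropy_rate mu S (N i) - e1 <= mean mu g &
      forall n, exists2 K, (n <= K)%N &
        forall x, g x <= Num.max 0 (word_info mu S (N i) K x)].
  by move=> i; exact: info_function.
(* The function [f] enters at level [0] only, where the weight [a 0] cancels the division. *)
pose phi i x := if i is 0%N then (a 0%N)^-1 * f x + g 0%N x else g i x.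
have bg i : bdmeas (g i) by have [] := gP i.
have bphi i : bdmeas (phi i).
  by case: i => [|i] /=; [apply: bdmeasD => //; exact: bdmeasZ|exact: bg].
have /choice [F FP] : forall i, exists F, [/\ bdmeas F, mean mu F = mean mu (phi i) &
   {ae mu, forall x, birkhoff_mean S (phi i) ^~ x @ \oo --> F x}].
  by move=> i; exact: birkhoff.
have bF i : bdmeas (F i) by have [] := FP i.
pose Phi n x := n%:R^-1 * weighted_sum S k a phi n x.
have bPhi n : bdmeas (Phi n).
  by apply: bdmeasZ; apply: bdmeas_sum => l _; apply: bdmeas_comp => //; exact: measurable_iter.
have cPhi : {ae mu, forall x, Phi ^~ x @ \oo --> \sum_(0 <= i < k) a i * F i x}.
  have := @ae_forall_ltn _ _ _ mu
    (fun i x => birkhoff_mean S (phi i) ^~ x @ \oo --> F i x) k.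
  move=> /(_ (fun i => let: And3 _ _ h := FP i in h)).
  by apply: filterS => x h; exact: weighted_sum_cvg.
have Hlt : H - eps / 2 < mean mu (fun x => \sum_(0 <= i < k) a i * F i x).
  rewrite mean_sum; last by move=> i _; exact: bdmeasZ.
  under eq_bigr => i _.
    rewrite meanZ//; have [_ -> _] := FP i.
    over.
  have phiE : \sum_(0 <= i < k) a i * mean mu (phi i) =
      mean mu f + \sum_(0 <= i < k) a i * mean mu (g i).
    rewrite !(big_ltn k0) /= addrA; congr (_ + _).
      rewrite meanD ?meanZ//; last exact: bdmeasZ.
      by rewrite mulrDr mulVKf ?gt_eqF.
    by apply: eq_big_nat => -[].
  rewrite phiE /H addrC.
  have : \sum_(0 <= i < k) a i * (entropy_rate mu S (N i) - e1)
      <= \sum_(0 <= i < k) a i * mean mu (g i).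
    rewrite !big_nat; apply: ler_sum => i /andP[_ ik].
    by apply: ler_wpM2l; [exact: a_ge0|have [] := gP i].
  under eq_bigr do rewrite mulrBr.
  rewrite sumrB -mulr_suml asum /e1 mulrC divfK ?gt_eqF//; lra.
have bsum : bdmeas (fun x => \sum_(0 <= i < k) a i * F i x).
  by apply: bdmeas_sum => i _; exact: bdmeasZ.
have [M [mG G0]] := eventually_pos bPhi bsum cPhi Hlt.
set G1 := \bigcap_(n in _) _ in mG G0.
(* By the maximal inequality, the points visiting [V] too often then have smaller measure than
   [G1]. *)
exists (delta * fine (mu G1)); first by rewrite mulr_gt0.
move=> V mV muV.
have mO : measurable (often_in S V delta) by exact: measurable_often_in.
(* Having [n >= 1] clears the factor [n^-1] and absorbs the rounding in the thresholds. *)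
exists (G1 `\` often_in S V delta), (maxn M 1); split.
- exact: measurableD.
- have mD : measurable (G1 `\` often_in S V delta) by exact: measurableD.
  have : fine (mu G1) <= fine (mu (G1 `\` often_in S V delta)) +
      fine (mu (often_in S V delta)).
    have bD := bdmeas_indic R mD; have bO := bdmeas_indic R mO.
    rewrite -!mean_indic// -meanD//; apply: mean_le.
    + exact: bdmeas_indic.
    + exact: bdmeasD.
    move=> x; rewrite !indicE in_setD.
    by case: (x \in G1); case: (x \in often_in _ _ _); rewrite ?addr0 ?add0r.
  have := often_in_le mS invS delta mV.
  have : fine (mu V) / delta < fine (mu G1) by rewrite ltr_pdivrMr// mulrC.
  rewrite -ler_pdivlMl// mulrC; lra.
move=> n; rewrite geq_max => /andP[Mn n1] b A sigma mA AV Asig.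
have n0 : 0 < n%:R :> R by rewrite ltr0n.
have phi_sum x : weighted_sum S k a phi n x = (a 0%N)^-1 * birkhoff_sum S f (t n 0%N) x +
    \sum_(0 <= l < L n) g (lev n l) (iter l S x).
  rewrite -/(weighted_sum S k a g n x) !weighted_sumE// !(big_ltn k0) addrA.
  congr (_ + _); last by apply: eq_big_nat => -[].
  have bs0 h : birkhoff_sum S h 0 x = 0 by rewrite /birkhoff_sum big_ord0.
  by rewrite /= !bs0 !subr0 /birkhoff_sum mulr_sumr -big_split.
have Ln : (L n)%:R <= (ck + 1) * n%:R.
  have /andP[_] := nceil_itv (mulr_ge0 (ltW ck0) (ltW n0)).
  move=> /ltW/le_trans; apply; rewrite mulrDl mul1r lerD2l.
  by rewrite ler1n.
have mD := measurableD mG mO.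
have Gh x : (G1 `\` often_in S V delta) x ->
    (H - eps / 2) * n%:R <= (a 0%N)^-1 * birkhoff_sum S f (t n 0%N) x +
     \sum_(0 <= l < L n) g (lev n l) (iter l S x).
  by move=> [/(_ n Mn) /= + _]; rewrite /Phi ler_pdivlMl// mulrC phi_sum.
have GO x : (G1 `\` often_in S V delta) x -> ~ often_in S V delta x by case.
apply: (le_trans (mass_bound bg (fun i => let: And4 _ _ _ h := gP i in h) (ltW th0)
  mA mD AV Asig GO Gh)).
rewrite ler_expR.
have thd : theta * delta = eps / 4 / (ck + 1) by rewrite /delta mulrC divfK ?gt_eqF.
have : (L n)%:R * (theta * delta + #|I|%:R * expR (- theta)) <= eps / 2 * n%:R.
  apply: (@le_trans _ _ ((ck + 1) * n%:R * (eps / 2 / (ck + 1)))).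
    apply: ler_pM => //; first by rewrite addr_ge0// mulr_ge0 ?expR_ge0 ?(ltW th0) ?(ltW delta0).
    have -> : eps / 2 / (ck + 1) = eps / 4 / (ck + 1) + eps / 4 / (ck + 1).
      by field; rewrite gt_eqF// addr_gt0.
    by rewrite thd lerD2l.
  rewrite le_eqVlt; apply/orP; left; apply/eqP; field.
  by rewrite gt_eqF// addr_gt0.
lra.
Qed.

End WeightedMass.

(** * Regularity, open covers and support *)

Section RealProbability.
Context d (T : measurableType d) (R : realType) (mu : probability T R).

Definition prob (A : set T) : R := fine (mu A).

Lemma prob_ge0 A : 0 <= prob A.
Proof. exact: fine_ge0. Qed.

Lemma prob_le A B : measurable A -> measurable B -> A `<=` B -> prob A <= prob B.
Proof.
move=> mA mB AB; apply: fine_le; [exact: fin_num_measure|exact: fin_num_measure|].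
by apply: le_measure => //; exact: mem_set.
Qed.

Lemma probU A B : measurable A -> measurable B -> prob (A `|` B) <= prob A + prob B.
Proof.
move=> mA mB; have mU := measurableU _ _ mA mB.
have bA := bdmeas_indic R mA; have bB := bdmeas_indic R mB.
rewrite /prob -!mean_indic// -meanD//; apply: mean_le.
- exact: bdmeas_indic.
- exact: bdmeasD.
move=> x; rewrite !indicE in_setU.
by case: (x \in A); case: (x \in B); rewrite ?addr0 ?add0r// lerDl.
Qed.

Lemma prob_le_sum (I : finType) (A : I -> set T) (B : set T) :
  (forall i, measurable (A i)) -> measurable B -> B `<=` \bigcup_i A i ->
  prob B <= \sum_i prob (A i).
Proof.
move=> mA mB BA; have bA i := bdmeas_indic R (mA i).
rewrite /prob -mean_indic//; under eq_bigr do rewrite -mean_indic//.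
rewrite -mean_sum//; apply: mean_le; [exact: bdmeas_indic|exact: bdmeas_sum|].
move=> x; rewrite [leLHS]indicE; have [/set_mem/BA[i _ Ax]|_] := boolP (x \in B).
  rewrite (bigD1 i)//= [in leRHS]indicE mem_set// lerDl.
  by apply: sumr_ge0 => j _; rewrite indicE.
by apply: sumr_ge0 => j _; rewrite indicE.
Qed.

Lemma prob_bigcup_tail (A : nat -> set T) (e : R) : 0 < e ->
  (forall n, measurable (A n)) -> {homo A : m n / (m <= n)%N >-> m `<=` n} ->
  exists n, prob (\bigcup_i A i `\` A n) < e.
Proof.
move=> e0 mA And; have mU : measurable (\bigcup_i A i) by exact: bigcupT_measurable.
have cv : (fun n => prob (A n)) @ \oo --> prob (\bigcup_i A i).
  apply: fine_cvg; rewrite fineK ?fin_num_measure//.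
  by apply: nondecreasing_cvg_mu => // m n mn; apply/subsetPset/And.
have [n h] : exists n, prob (\bigcup_i A i) - e < prob (A n).
  have [|n h] := @filter_ex _ \oo _ (fun n => prob (\bigcup_i A i) - e < prob (A n)).
    by apply: cvgr_gt cv _ _; rewrite gtrBl.
  by exists n.
have mD := measurableD mU (mA n).
have bU := bdmeas_indic R mU; have bn := bdmeas_indic R (mA n).
exists n; move: h; rewrite ltrBlDr -ltrBlDl; apply: le_lt_trans.
rewrite /prob -!mean_indic// -meanB//; apply: mean_le.
- exact: bdmeas_indic.
- exact: bdmeasB.
move=> x; rewrite !indicE in_setD; have [xn|] := boolP (x \in A n).
  rewrite andbF mem_set ?subrr//.
  by exists n => //; exact: set_mem xn.
by rewrite andbT subr0.
Qed.

Lemma prob_bigcup_le (A : nat -> set T) (c : R) : (forall n, measurable (A n)) ->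
  (forall n, \sum_(i < n) prob (A i) <= c) -> prob (\bigcup_i A i) <= c.
Proof.
move=> mA cA; apply/ler_addgt0Pr => e e0.
pose B n := \bigcup_(i in [set i | (i < n)%N]) A i.
have mB n : measurable (B n) by exact: bigcup_measurable.
have UB : \bigcup_i A i = \bigcup_n B n.
  apply/seteqP; split => x [i _]; first by exists i.+1 => //; exists i => /=.
  by move=> [j _ Ax]; exists j.
have [|n hn] := prob_bigcup_tail e0 mB.
  by move=> m n mn x [i /= im Ax]; exists i => //=; exact: leq_trans mn.
have mU : measurable (\bigcup_i A i) by exact: bigcupT_measurable.
rewrite -UB in hn; have mD := measurableD mU (mB n).
apply: (@le_trans _ _ (prob (B n `|` (\bigcup_i A i `\` B n)))).
  apply: prob_le => //; first exact: measurableU.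
  by move=> x Ax; have [Bn|Bn] := pselect (B n x); [left|right].
apply: (le_trans (probU (mB n) mD)); apply: lerD (ltW hn).
apply: le_trans (cA n).
apply: (prob_le_sum (A := fun i : 'I_n => A i)) => // x [i /= im Ax].
by exists (Ordinal im).
Qed.

End RealProbability.

Section Regularity.
Context d (T : measurableType d) (R : realType) (mu : probability T R).
Context (Y : pmetricType R) (phi : T -> borel Y).
Hypothesis mphi : measurable_fun setT phi.

Lemma open_borel (W : set Y) : open W -> measurable (W : set (borel Y)).
Proof. by move=> oO; exact: sub_sigma_algebra. Qed.

Lemma closed_borel (C : set Y) : closed C -> measurable (C : set (borel Y)).
Proof.
move=> cC; rewrite -[C]setCK; apply: measurableC; apply: open_borel.
exact: closed_openC.
Qed.

Lemma preimage_borel (A : set (borel Y)) : measurable A -> measurable (phi @^-1` A).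
Proof. by move=> mA; rewrite -[X in measurable X]setTI; exact: (mphi measurableT mA). Qed.

(** Regularity for the image of [mu] under [phi], written through preimages so that only [mu]
    occurs. *)
Definition regular (A : set Y) := forall e : R, 0 < e -> exists C W,
  [/\ closed C, open W, C `<=` A, A `<=` W & prob mu (phi @^-1` (W `\` C)) < e].

Let mdiff (C W : set Y) : closed C -> open W -> measurable (phi @^-1` (W `\` C)).
Proof.
by move=> cC oO; apply: preimage_borel; apply: measurableD; [exact: open_borel|exact: closed_borel].
Qed.

(** An open set is the increasing union of the closed sets [C n], which avoid the interiors of the
    balls of radius [1 / (n + 1)] centred in the complement; then continuity from below applies. *)
Lemma regular_open (U : set Y) : open U -> regular U.
Proof.
move=> oU e e0.
pose B n := \bigcup_(y in ~` U) (ball y (n.+1%:R^-1 : R))°.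
pose C n := ~` B n.
have oB n : open (B n) by apply: bigcup_open => y _; exact: open_interior.
have cC n : closed (C n) by exact: open_closedC.
have CU n : C n `<=` U.
  move=> x Cx; apply: contrapT => Ux; apply: Cx; exists x => //.
  by apply: nbhsx_ballx; rewrite invr_gt0.
have Cnd : {homo C : m n / (m <= n)%N >-> m `<=` n}.
  move=> m n mn; apply: subsetC => x [y Uy byx]; exists y => //.
  apply: interiorS byx; apply: le_ball.
  by rewrite lef_pV2 ?posrE// ler_nat.
have UC : U `<=` \bigcup_n C n.
  move=> x Ux; have /nbhs_ballP[r r0 bU] : nbhs x U by exact: open_nbhs_nbhs.
  rewrite /= in r0; have [n nr] : exists n : nat, n.+1%:R^-1 < r.
    exists (Num.truncn r^-1); rewrite invf_plt ?posrE//.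
    by rewrite truncnS_gt.
  exists n => // -[y Uy /interior_subset byx]; apply: Uy; apply: bU.
  apply: le_ball (ltW nr) _ _; exact: ball_sym.
have [||n hn] := @prob_bigcup_tail _ T R mu (fun n => phi @^-1` C n) e e0.
- by move=> n; apply: preimage_borel; exact: closed_borel.
- by move=> m n mn; apply: preimage_subset; exact: Cnd.
exists (C n), U; split=> //; apply: le_lt_trans hn; apply: prob_le.
- exact: mdiff.
- apply: measurableD; last by apply: preimage_borel; exact: closed_borel.
  by apply: bigcupT_measurable => i; apply: preimage_borel; exact: closed_borel.
by move=> x [/= /UC [i _ Cx] nC]; split=> //; exists i.
Qed.

(** The regular sets form a sigma-algebra containing the open sets. *)
Lemma borel_regular (A : set (borel Y)) : measurable A -> regular A.
Proof.
have h : sigma_algebra setT regular.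
  split.
  - move=> e e0; exists set0, set0; split=> //; first exact: closed0.
      exact: open0.
    by rewrite setD0 preimage_set0 /prob measure0.
  - move=> B rB e e0; have [K [W [cK oO KB BO lt]]] := rB e e0.
    rewrite setTD; exists (~` W), (~` K); split.
    + exact: open_closedC.
    + exact: closed_openC.
    + exact: subsetC.
    + exact: subsetC.
    by rewrite setDE setCK setIC -setDE.
  - move=> B rB e e0.
    (* The errors for the [B n] sum to at most [e / 2]; the other half pays for cutting the union of
       the closed sets, which need not be closed, to a finite one. *)
    have z0 n : 0 < e / 2 ^+ n.+2 by rewrite divr_gt0// exprn_gt0.
    have /choice [CO COP] : forall n, exists CO : set Y * set Y, [/\ closed CO.1, open CO.2,
        CO.1 `<=` B n, B n `<=` CO.2 & prob mu (phi @^-1` (CO.2 `\` CO.1)) < e / 2 ^+ n.+2].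
      by move=> n; have [K [W h]] := rB n _ (z0 n); exists (K, W).
    pose C n := \bigcup_(i in [set i | (i < n)%N]) (CO i).1.
    pose D n := phi @^-1` ((CO n).2 `\` (CO n).1).
    have mD n : measurable (D n) by have [a b _ _ _] := COP n; exact: mdiff.
    have cC n : closed (C n).
      by apply: closed_bigcup => // i _; have [] := COP i.
    have oO : open (\bigcup_i (CO i).2) by apply: bigcup_open => i _; have [] := COP i.
    have mC n : measurable (phi @^-1` C n) by apply: preimage_borel; exact: closed_borel.
    have e2 : 0 < e / 2 by rewrite divr_gt0.
    have [|n hn] := prob_bigcup_tail mu e2 mC.
      by move=> m n mn x [i /= im Cx]; exists i => //=; exact: leq_trans mn.
    exists (C n), (\bigcup_i (CO i).2); split=> //.
    + by move=> x [i _ Cx]; exists i => //; have [_ _ CB _ _] := COP i; exact: CB.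
    + by move=> x [i _ Bx]; exists i => //; have [_ _ _ BO _] := COP i; exact: BO.
    have mU : measurable (\bigcup_i D i) by exact: bigcupT_measurable.
    have mCU : measurable (\bigcup_i (phi @^-1` C i) `\` phi @^-1` C n).
      by apply: measurableD => //; exact: bigcupT_measurable.
    have le2 : prob mu (\bigcup_i D i) <= e / 2.
      apply: prob_bigcup_le => // m.
      apply: (@le_trans _ _ (\sum_(i < m) e / 2 ^+ i.+2)).
        by apply: ler_sum => i _; have [_ _ _ _ /ltW] := COP i.
      suff -> : \sum_(i < m) e / 2 ^+ i.+2 = e / 2 - e / 2 ^+ m.+1.
        by rewrite gerBl divr_ge0 ?(ltW e0)// exprn_ge0.
      elim: m => [|m IH]; first by rewrite big_ord0 expr1 subrr.
      by rewrite big_ord_recr/= IH !exprS; field; exact: expf_neq0.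
    apply: (@le_lt_trans _ _ (prob mu ((\bigcup_i D i) `|`
        (\bigcup_i (phi @^-1` C i) `\` phi @^-1` C n)))).
      apply: prob_le; [exact: mdiff|exact: measurableU|].
      move=> x [/= [i _ Ox] nC]; have [Cx|Cx] := pselect ((CO i).1 (phi x)).
        by right; split => //; exists i.+1 => //; exists i => /=.
      by left; exists i.
    apply: (le_lt_trans (probU mu mU mCU)); lra.
move=> mA; apply: (smallest_sub h _ mA); exact: regular_open.
Qed.

End Regularity.

Section OpenCovers.
Context d (T : measurableType d) (R : realType) (mu : probability T R).
Context (Y : pmetricType R) (phi : T -> borel Y).
Hypothesis mphi : measurable_fun setT phi.

Lemma pushforward_prob (A : set (borel Y)) : measurable A ->
  pushforward mu phi A = (prob mu (phi @^-1` A))%:E.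
Proof.
move=> mA; rewrite /prob fineK// fin_num_measure//.
exact: preimage_borel.
Qed.

(* With closed sets [K l] inside the cells, [U l] is the complement of the other
   [K l'] and the exceptional set [U 0] is the complement of all of them. *)
Lemma partition_open_cover m (alpha : 'I_m -> set Y) (e : R) :
  is_borel_partition alpha -> 0 < e -> exists U : 'I_m.+1 -> set Y,
  [/\ is_open_cover U, (cover_dist (pushforward mu phi) U alpha < e%:E)%E,
      prob mu (phi @^-1` U ord0) < e &
      forall l x, U (lift ord0 l) x -> ~ U ord0 x -> alpha l x].
Proof.
move=> [cov triv meas] e0.
have m1 : 0 < m.+1%:R :> R by rewrite ltr0n.
(* Every symmetric difference lies in the exceptional set, of mass at most [m * e'], so the [m.+1]
   terms of [cover_dist] add up to at most [m.+1 * m * e' < e]. *)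
pose e' := e / m.+1%:R / m.+1%:R.
have e'0 : 0 < e' by rewrite !divr_gt0.
have /choice [KW KWP] : forall l, exists KW : set Y * set Y, [/\ closed KW.1, open KW.2,
    KW.1 `<=` alpha l, alpha l `<=` KW.2 & prob mu (phi @^-1` (KW.2 `\` KW.1)) < e'].
  by move=> l; have [K [W h]] := borel_regular mu mphi (meas l) e'0; exists (K, W).
pose K l := (KW l).1.
have cK l : closed (K l) by have [] := KWP l.
have Kalpha l : K l `<=` alpha l by have [] := KWP l.
pose U0 := ~` \bigcup_l K l.
pose U (i : 'I_m.+1) := if unlift ord0 i is Some l
  then ~` \bigcup_(l' in [set l' | l' != l]) K l' else U0.
have UE0 : U ord0 = U0 by rewrite /U unlift_none.
have UEl l : U (lift ord0 l) = ~` \bigcup_(l' in [set l' | l' != l]) K l'.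
  by rewrite /U liftK.
have oU i : open (U i).
  rewrite /U; case: unliftP => [l _|_]; apply: closed_openC.
    by apply: closed_bigcup => [|j _]; [exact: finite_finset|exact: cK].
  by apply: closed_bigcup => [|j _]; [exact: finite_finset|exact: cK].
have mUp i : measurable (phi @^-1` U i) by apply: preimage_borel => //; exact: open_borel.
have UK l x : U (lift ord0 l) x -> ~ U ord0 x -> alpha l x.
  rewrite UEl UE0 => nK /contrapT[l' _ Kx]; have [<-|l'l] := eqVneq l' l.
    exact: Kalpha.
  by case: nK; exists l'.
have alpha_inj l l' x : alpha l x -> alpha l' x -> l = l'.
  by move=> ax ax'; apply: triv => //; exists x.
have alphaU l : alpha l `<=` U (lift ord0 l).
  move=> x ax; rewrite UEl => -[l' /= /eqP l'l /Kalpha ax']; apply: l'l.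
  exact: alpha_inj ax' ax.
have sym l : U (lift ord0 l) `+` alpha l `<=` U ord0.
  move=> x [[Ux ax]|[ax Ux]]; last by case: Ux; exact: alphaU.
  by apply: contrapT => U0x; apply: ax; exact: UK.
have pU0 : prob mu (phi @^-1` U ord0) <= m%:R * e'.
  have mW l : measurable (phi @^-1` ((KW l).2 `\` (KW l).1)).
    apply: preimage_borel => //; apply: measurableD.
      by apply: open_borel; have [] := KWP l.
    exact: closed_borel (cK l).
  apply: le_trans (prob_le_sum mu
    (A := fun l => phi @^-1` ((KW l).2 `\` (KW l).1)) mW (mUp ord0) _) _.
    move=> x; rewrite UE0 => /= nK.
    have [l _ ax] : (\bigcup_l alpha l) (phi x) by rewrite cov.
    exists l => //; have [_ _ _ aW _] := KWP l; split; first exact: aW.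
    by move=> Kx; apply: nK; exists l.
  apply: (@le_trans _ _ (\sum_(l < m) e')).
    by apply: ler_sum => l _; have [_ _ _ _ /ltW] := KWP l.
  by rewrite sumr_const card_ord mulr_natl.
have me' : m.+1%:R * (m%:R * e') < e.
  rewrite /e' mulrCA [e / _ / _]mulrC mulVKf ?gt_eqF// mulrCA.
  rewrite -[ltRHS]mulr1 ltr_pM2l// ltr_pdivrMr// mul1r ltr_nat.
  by [].
exists U; split=> //.
- split=> //; apply/seteqP; split => // y _.
  have [l _ ax] : (\bigcup_l alpha l) y by rewrite cov.
  by exists (lift ord0 l) => //; exact: alphaU.
- have mS l : measurable ((U (lift ord0 l) `+` alpha l) : set (borel Y)).
    by apply: measurableU; apply: measurableD => //; exact: open_borel.
  rewrite /cover_dist pushforward_prob; last exact: open_borel.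
  under eq_bigr do rewrite pushforward_prob//.
  rewrite sumEFin -EFinD lte_fin; apply: le_lt_trans me'.
  rewrite -natr1 addrC mulrDl mul1r; apply: lerD => //.
  apply: (@le_trans _ _ (\sum_(l < m) m%:R * e')).
    apply: ler_sum => l _; apply: le_trans pU0; apply: prob_le => //.
      exact: preimage_borel.
    by apply: preimage_subset; exact: sym.
  by rewrite sumr_const card_ord -[leLHS]mulr_natl.
- apply: le_lt_trans me'; apply: (le_trans pU0).
  by apply: ler_peMl; [apply: mulr_ge0 => //; exact: ltW|rewrite ler1n].
Qed.

End OpenCovers.

Section Support.
Context (R : realType) (X : pmetricType R) (mu : probability (borel X) R).

Lemma closed_supp : closed (supp mu).
Proof.
rewrite -[supp mu]setCK; apply: open_closedC.
rewrite openE => x /= /existsNP[W /not_implyP[oW /not_implyP[Wx nW]]].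
apply: (filterS (P := W)); last exact: open_nbhs_nbhs.
by move=> y Wy sy; apply: nW; exact: sy.
Qed.

(** Every point off the support has a null open neighbourhood. Closed subsets of the complement of
    the support are compact, so finitely many such neighbourhoods cover them; regularity does the
    rest. *)
Lemma prob_supp : compact [set: X] -> prob mu (~` supp mu) = 0.
Proof.
move=> cX; apply/eqP; rewrite eq_le prob_ge0 andbT.
apply/ler_addgt0Pr => e e0; rewrite add0r.
have oS : open (~` supp mu) := closed_openC closed_supp.
have /choice [W WP] : forall x : X, exists W : set X,
    ~ supp mu x -> [/\ open W, W x & prob mu W = 0].
  move=> x; have [sx|/existsNP[W /not_implyP[oW /not_implyP[Wx nW]]]] := pselect (supp mu x).
    by exists set0.
  exists W => _; split=> //; apply/eqP; rewrite eq_le prob_ge0 andbT.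
  rewrite leNgt; apply/negP => W0; apply: nW.
  have mW : measurable (W : set (borel X)) by exact: open_borel.
  by rewrite -[mu W]fineK ?fin_num_measure// lte_fin.
have mid : measurable_fun setT (id : borel X -> borel X) by exact: measurable_id.
have [K [V [cK oV KS SV lt]]] := regular_open mu mid oS e0.
have mK : measurable (K : set (borel X)) by exact: closed_borel.
have mV : measurable (V : set (borel X)) by exact: open_borel.
have mS : measurable (~` supp mu : set (borel X)) by exact: open_borel.
have : compact K by apply: subclosed_compact cX _.
rewrite compact_cover => /(_ X (~` supp mu) W) [|| D DS KD].
- by move=> x /WP[].
- by move=> x /KS nx; exists x => //; have [] := WP _ nx.
have K0 : prob mu K <= 0.
  have D0 (i : D) : [/\ open (W (val i)), W (val i) (val i) & prob mu (W (val i)) = 0].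
    by apply: WP; exact: (set_mem (DS _ (valP i))).
  apply: (@le_trans _ _ (\sum_(i : D) prob mu (W (val i)))).
    apply: prob_le_sum => //.
      by move=> i; apply: open_borel; have [] := D0 i.
    by move=> x /KD[i /= iD Wx]; exists [` iD]%fset.
  by rewrite big1// => i _; have [] := D0 i.
have mVK := measurableD mV mK.
apply: (@le_trans _ _ (prob mu (K `|` (V `\` K)))).
  apply: prob_le => //; first exact: measurableU.
  by move=> x /SV Vx; have [Kx|Kx] := pselect (K x); [left|right].
apply: (le_trans (probU mu mK mVK)).
by rewrite -[leRHS]add0r; apply: lerD => //; exact: ltW lt.
Qed.

End Support.

(** * Entropy of the joined partitions *)

Section Coding.
Context {X : Type}.

(** For an equivalence [E], the nonempty members of [P] are its classes; the empty set may belong to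
    [P] as well, since empty cells and joins produce it. *)
Definition codes (P : set (set X)) (E : X -> X -> Prop) :=
  (forall A x, P A -> A x -> A = [set y | E x y]) /\
  (forall x, P [set y | E x y]).

Lemma codes_pullback (Y : Type) (g : X -> Y) (m : nat) (alpha : 'I_m -> set Y)
    (cell : X -> 'I_m) : trivIset setT alpha -> (forall x, alpha (cell x) (g x)) ->
  codes (pullback g (range alpha)) (fun x y => cell x = cell y).
Proof.
move=> triv cellP.
have cellE l x : alpha l (g x) -> cell x = l.
  by move=> ax; apply: triv => //; exists (g x); split => //; exact: cellP.
split=> [_ x [_ [l _ <-] <-] /= ax|x].
  apply/seteqP; split => y /=.
    by move=> ay; rewrite (cellE _ _ ax) (cellE _ _ ay).
  by rewrite (cellE _ _ ax) => ->; exact: cellP.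
exists (alpha (cell x)); first by exists (cell x).
apply/seteqP; split => y /=; first by move=> /cellE ->.
by move=> ->; exact: cellP.
Qed.

Lemma codes_join (I : Type) (D : set I) (V : I -> set (set X)) (E : I -> X -> X -> Prop) :
  (forall i, D i -> codes (V i) (E i)) ->
  codes (join D V) (fun x y => forall i, D i -> E i x y).
Proof.
move=> VE; split=> [_ x [B BV <-] Bx|x].
  apply/seteqP; split => y h i Di.
    have [+ _] := VE i Di => /(_ (B i) x (BV i Di) (Bx i Di)) BE.
    by have := h i Di; rewrite BE.
  have [+ _] := VE i Di => /(_ (B i) x (BV i Di) (Bx i Di)) ->.
  exact: h.
exists (fun i => [set y | E i x y]) => [i Di|]; first by have [_] := VE i Di.
by [].
Qed.

Lemma codes_preimage (P : set (set X)) (E : X -> X -> Prop) (g : X -> X) :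
  codes P E -> codes (pullback g P) (fun x y => E (g x) (g y)).
Proof.
move=> [PE EP]; split=> [_ x [B PB <-] /= Bx|x].
  by rewrite (PE _ _ PB Bx).
by exists [set y | E (g x) y].
Qed.

End Coding.

Section EntropyCoding.
Context (R : realType) (X : ptopologicalType) (mu : probability (borel X) R).

(** The empty cell and the values not taken by [V] contribute [0], and distinct values taken have
    distinct fibres, so the sum over cells is a sum over values. *)
Lemma entropy_codes (P : set (set X)) (W : finType) (V : X -> W) :
  codes P (fun x y => V y = V x) ->
  entropy mu P = \sum_w - (law mu (V : borel X -> W) w * ln (law mu (V : borel X -> W) w)).
Proof.
move=> [PE EP]; pose F (A : set X) : R := - (fine (mu A) * ln (fine (mu A))).
have F0 : F set0 = 0 by rewrite /F measure0/= mul0r oppr0.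
pose W1 := [set w | V @^-1` [set w] !=set0].
pose Q := [set V @^-1` [set w] | w in W1].
have QP : Q `<=` P by move=> _ [w [x <-] <-]; exact: EP.
rewrite /entropy -(@fsbig_widen _ _ _ _ Q P) //; last first.
  move=> A [PA nQ] /=; apply: contrapT => FA.
  have [x Ax] : A !=set0 by apply/set0P/eqP => A0; apply: FA; rewrite A0; exact: F0.
  by apply: nQ; exists (V x); [exists x|rewrite (PE _ _ PA Ax)].
rewrite fsbig_image; last first.
  move=> w w' /set_mem [x Vx] _ e.
  have /= <- : (V @^-1` [set w']) x by rewrite -e.
  exact: esym Vx.
rewrite (@fsbig_widen _ _ _ _ _ setT)//; last first.
  move=> w [_ /= nw]; have -> : V @^-1` [set w] = set0; last exact: F0.
  by apply/seteqP; split => // x Vx; apply: nw; exists x.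
by rewrite [RHS]bigfs ?set_true// ?index_enum_uniq// => w; rewrite mem_index_enum.
Qed.

End EntropyCoding.

Section Continuity.
Context (R : realType).

Lemma continuous_borel (X Y : ptopologicalType) (g : X -> Y) : continuous g ->
  measurable_fun setT (g : borel X -> borel Y).
Proof.
move=> cg; apply: (@measurability _ _ (borel X) (borel Y) setT g (@open Y)) => // _ [W oW <-].
rewrite setTI; apply: sub_sigma_algebra.
by apply: open_comp => // x _; exact: cg.
Qed.

Lemma continuous_bdmeas (X : pmetricType R) (f : X -> R) :
  compact [set: X] -> continuous f -> bdmeas (f : borel X -> R).
Proof.
move=> cX cf; split.
  apply: (measurability _ (RGenInftyO.measurableE R)) => // _ [_ [x ->] <-].
  rewrite setTI; apply: sub_sigma_algebra.
  apply: open_comp => [y _|]; first exact: cf.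
  exact: interval_open.
have /compact_bounded [M [Mr MP]] : compact (f @` setT).
  by apply: continuous_compact => //; exact: continuous_subspaceT.
exists (M + 1) => x; apply: (MP (M + 1)); first by rewrite ltrDl.
by exists x.
Qed.

End Continuity.

(** * Names that code the joined partitions *)

Section Names.
Context (R : realType) (k : nat) (X : nat -> pmetricType R).
Variables (p : forall i, X i -> X i.+1) (S : X 0%N -> X 0%N).
Variables (m : nat -> nat) (alpha : forall i, 'I_(m i) -> set (X i)).
Variable mu : probability (borel (X 0%N)) R.
Arguments alpha : clear implicits.
Hypothesis halpha : forall i, (i < k)%N -> is_borel_partition (alpha i).
Hypothesis ctau : forall i, (i < k)%N -> continuous (tau p i).
Hypothesis cS : continuous S.
Hypothesis invS : invariant_measure mu S.

Variable cell : nat -> X 0%N -> nat.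
Hypothesis cellP : forall j, (j < k)%N -> forall x,
  exists2 l : 'I_(m j), nat_of_ord l = cell j x & alpha j l (tau p j x).

Lemma cell_unique j (l : 'I_(m j)) x : (j < k)%N ->
  alpha j l (tau p j x) -> cell j x = l.
Proof.
move=> jk ax; have [l' <- ax'] := cellP jk x; have [_ triv _] := halpha jk.
by congr nat_of_ord; apply: triv => //; exists (tau p j x).
Qed.

Let D := (\sum_(j < k) m j)%N.

Let cell_le j x : (j < k)%N -> (cell j x < D.+1)%N.
Proof.
move=> jk; have [l <- _] := cellP jk x; rewrite ltnS.
apply: (leq_trans (ltnW (ltn_ord l))).
by rewrite /D (bigD1 (Ordinal jk))//= leq_addr.
Qed.

(** The chain argument wants one alphabet for all levels, each name being a function of the previous
    one; so the coordinates below [i] are blanked instead of dropped, and [D] bounds all cell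
    numbers to make [inord] faithful. *)
Definition name i (x : X 0%N) : {ffun 'I_k -> 'I_D.+1} :=
  [ffun j : 'I_k => if (j < i)%N then ord0 else inord (cell j x)].

Lemma nameP i x y : name i x = name i y <->
  forall j, (i <= j < k)%N -> cell j x = cell j y.
Proof.
split=> [/ffunP e j /andP[ij jk]|e].
  have := e (Ordinal jk); rewrite !ffunE /= ltnNge ij /=.
  by move=> /(congr1 (@nat_of_ord _)); rewrite !inordK//; exact: cell_le.
apply/ffunP => j; rewrite !ffunE; case: ltnP => // ij.
by rewrite e// ij ltn_ord.
Qed.

Definition coarsen (j : nat) (w : {ffun 'I_k -> 'I_D.+1}) : {ffun 'I_k -> 'I_D.+1} :=
  [ffun l : 'I_k => if (l < j)%N then ord0 else w l].

Lemma name_coarsen i j x : (i <= j)%N -> name j x = coarsen j (name i x).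
Proof.
move=> ij; apply/ffunP => l; rewrite !ffunE; case: ltnP => // jl.
by rewrite ltnNge (leq_trans ij jl).
Qed.

Lemma finmeas_name i : finmeas (name i : borel (X 0%N) -> _).
Proof.
move=> w; rewrite (_ : _ @^-1` _ = \bigcap_(j in [set: 'I_k])
    [set x | (if (j < i)%N then ord0 else inord (cell j x)) = w j]); last first.
  apply/seteqP; split => x /= => [<- j _ /=|h]; first by rewrite ffunE.
  by apply/ffunP => j; rewrite ffunE; exact: h.
apply: fin_bigcap_measurable => // j _; case: (ltnP j i) => ji /=.
  have [wj|wj] := eqVneq ord0 (w j).
    by rewrite (_ : [set _ | _] = setT)//; apply/seteqP; split.
  by rewrite (_ : [set _ | _] = set0)//; apply/seteqP; split => // x /= /eqP; rewrite (negbTE wj).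
have jk := ltn_ord j.
rewrite (_ : [set _ | _] = \bigcup_(l in [set l : 'I_(m j) | inord l = w j])
    (tau p j @^-1` alpha j l)); last first.
  apply/seteqP; split => x /=.
    by move=> e; have [l le ax] := cellP jk x; exists l => //=; rewrite le.
  by move=> [l /= <- ax]; rewrite (cell_unique jk ax).
apply: fin_bigcup_measurable; first exact: finite_finset.
move=> l _; rewrite -[X in measurable X]setTI.
have [_ _ meas] := halpha jk.
exact: (continuous_borel (ctau jk) measurableT (meas l)).
Qed.

(** The iterated join and the words of names separate points in the same way, by the cells visited
    at times below [n]; so the entropies agree for each [n]. *)
Lemma ks_entropy_name i :
  ks_entropy mu S (join [set j | (i <= j < k)%N]
    (fun j => pullback (tau p j) (range (alpha j)))) =
  entropy_rate mu (S : borel (X 0%N) -> borel (X 0%N)) (name i).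
Proof.
have mS := continuous_borel cS.
rewrite /ks_entropy; apply/cvg_lim => //.
have := word_entropy_cvg mS invS (@finmeas_name i).
set P := join _ _.
suff PE n : entropy mu (iter_join S P n) =
    word_entropy mu (S : borel (X 0%N) -> borel (X 0%N)) (name i) n.
  by under [X in _ -> X @ _ --> _]eq_fun do rewrite PE.
rewrite /word_entropy; pose S' : borel (X 0%N) -> borel (X 0%N) := S.
apply: (@entropy_codes _ (X 0%N) mu (iter_join S P n) _ (word S' (name i) n)).
have cP : codes P (fun x y => forall j, (i <= j < k)%N -> cell j x = cell j y).
  apply: codes_join => j /= /andP[_ jk].
  have /choice [c cE] : forall x, exists l : 'I_(m j),
      nat_of_ord l = cell j x /\ alpha j l (tau p j x).
    by move=> x; have [l] := cellP jk x; exists l.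
  have [_ triv _] := halpha jk.
  have := codes_pullback triv (fun x => (cE x).2).
  rewrite (_ : (fun x y => c x = c y) = (fun x y => cell j x = cell j y))//.
  apply/funext => x; apply/funext => y; apply/propext.
  by rewrite -(cE x).1 -(cE y).1; split=> [->//|]; exact: val_inj.
have := codes_join (D := `I_n) (fun l _ => codes_preimage (iter l S) cP).
rewrite (_ : (fun x y => forall l, _ -> _) =
  (fun x y => word S' (name i) n y = word S' (name i) n x))//.
apply/funext => x; apply/funext => y; apply/propext; rewrite wordP.
by split=> h l ln; [apply/esym/nameP|apply/nameP/esym]; exact: h.
Qed.

End Names.

(** * Mass distribution principle *)

Section MassDistribution.
Context (R : realType) (k : nat) (a : nat -> R) (X : nat -> pmetricType R).
Variables (S : X 0%N -> X 0%N) (p : forall i, X i -> X i.+1).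
Variables (U : forall i, set (set (X i))) (f : X 0%N -> R) (Z : set (X 0%N)).
Arguments U : clear implicits.
Variable mu : probability (borel (X 0%N)) R.
Hypotheses (cS : continuous S) (bf : bdmeas (f : borel (X 0%N) -> R)).
Hypotheses (mZ : measurable (Z : set (borel (X 0%N)))) (Z1 : prob mu (~` Z) = 0).

Let t n := nceil (a 0%N * n%:R).

(** Every admissible collection covers [Z], which carries all the mass, and each of its terms is at
    least the mass of [A j] inside [G]; countable subadditivity concludes. *)
Lemma Lambda_N_mass (s : R) (G : set (borel (X 0%N))) M :
  measurable G ->
  (forall n, (M <= n)%N -> forall B, weighted_join k a S p U n B ->
     forall A : set (borel (X 0%N)), measurable A -> A `<=` B -> forall sigma : R,
     (forall x, A x -> birkhoff_sum S f (t n) x <= sigma) ->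
     prob mu (A `&` G) <= expR (- s * n%:R + (a 0%N)^-1 * sigma)) ->
  forall N, (M <= N)%N -> ((prob mu G)%:E <= Lambda_N k a S p U f Z s N)%E.
Proof.
move=> mG mass N MN; apply: le_ereal_inf_tmp => _ [J [n [A [Nn ZA mA AB ->]]]].
pose F j : set (borel (X 0%N)) := if j \in J then A j `&` G else set0.
have mF j : measurable (F j).
  by rewrite /F; case: ifPn => // /set_mem Jj; apply: measurableI => //; exact: mA.
have mGZ : measurable (G `&` Z) by exact: measurableI.
have mZC : measurable (~` Z : set (borel (X 0%N))) by exact: measurableC.
have GZ : prob mu G <= prob mu (G `&` Z).
  rewrite -[leRHS]addr0 -Z1; apply: le_trans (probU mu mGZ mZC).
  apply: prob_le => //; first exact: measurableU.
  by move=> x Gx; have [Zx|Zx] := pselect (Z x); [left|right].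
have GF : G `&` Z `<=` \bigcup_j F j.
  move=> x [Gx /ZA[j Jj Ax]]; exists j => //.
  by rewrite /F mem_set.
apply: (@le_trans _ _ (mu (G `&` Z))).
  by rewrite -[leRHS]fineK ?fin_num_measure// lee_fin.
have sub := @measure_sigma_subadditive _ _ _ mu (G `&` Z) F mF mGZ GF.
apply: (le_trans sub).
rewrite nneseries_esumT//= [leRHS]esum_mkcond; apply: le_esum => j _.
rewrite /F; case: ifPn => [/set_mem Jj|_]; last by rewrite measure0.
have mAG : measurable (A j `&` G : set (borel (X 0%N))) by apply: measurableI => //; exact: mA.
set sup := ereal_sup _.
(* For an empty member the supremum is infinite and the term is handled apart; otherwise the
   supremum is finite, as [f] is bounded, and can serve as [sigma]. *)
have [A0|/set0P[x0 Ax0]] := eqVneq (A j) set0.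
  by rewrite A0 set0I measure0 expeR_ge0.
have [B wB AjB] := AB j Jj.
have [C bC] := (bdmeas_birkhoff_sum (continuous_borel cS) (t (n j)) bf).2.
have supF : sup \is a fin_num.
  rewrite fin_numE; apply/andP; split; apply/eqP => sE.
    have : ((birkhoff_sum S f (t (n j)) x0)%:E <= sup)%E.
      by apply: ereal_sup_ubound; exists x0.
    by rewrite sE leeNy_eq.
  have : (sup <= C%:E)%E.
    apply: ge_ereal_sup => _ [x _ <-]; rewrite lee_fin.
    by apply: le_trans (bC x); exact: ler_norm.
  by rewrite sE leye_eq.
have := mass (n j) (leq_trans MN (Nn j Jj)) B wB (A j) (mA j Jj) AjB (fine sup).
rewrite -lee_fin /prob fineK ?fin_num_measure// => h.
rewrite -[sup]fineK// -EFinM -EFinD /=; apply: h => x Ax.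
by rewrite -lee_fin fineK//; apply: ereal_sup_ubound; exists x.
Qed.

Lemma Lambda_ge (s c : R) M :
  (forall N, (M <= N)%N -> (c%:E <= Lambda_N k a S p U f Z s N)%E) ->
  (c%:E <= Lambda k a S p U f Z s)%E.
Proof.
move=> h; apply: lime_ge; last by exists M.
apply: ereal_nondecreasing_is_cvgn => N N' NN'.
apply: ereal_inf_le_tmp => _ [J [n [A [Nn ZA mA AB ->]]]].
exists J, n, A; split=> // j Jj; exact: leq_trans NN' (Nn j Jj).
Qed.

Lemma pressure_ge (h c : R) : 0 < c ->
  (forall s, s < h -> (c%:E <= Lambda k a S p U f Z s)%E) ->
  (h%:E <= pressure k a S p U f Z)%E.
Proof.
move=> c0 L; apply: le_ereal_inf_tmp => _ [s /= Ls <-].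
rewrite lee_fin leNgt; apply/negP => /L; rewrite Ls lee_fin leNgt.
by rewrite c0.
Qed.

End MassDistribution.

(** * Choice of the covers and lower bound for the weighted pressure *)

Unset Implicit Arguments.
Set Strict Implicit.
Set Printing Implicit Defensive.

Theorem theorem3p3 (R : realType) (k : nat) (a : nat -> R)
    (X : nat -> pmetricType R) (T : forall i, X i -> X i)
    (p : forall i, X i -> X i.+1) (f : X 0%N -> R)
    (m : nat -> nat) (alpha : forall i, 'I_(m i) -> set (X i))
    (mu : probability (borel (X 0%N)) R) (eps : R) :
  (1 <= k)%N ->
  0 < a 0%N ->
  (forall i, (1 <= i < k)%N -> 0 <= a i) ->
  (forall i, (i < k)%N -> tds (T i)) ->
  (forall i, (i.+1 < k)%N -> factor_map (T i) (T i.+1) (p i)) ->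
  continuous f ->
  (forall i, (i < k)%N -> is_borel_partition (alpha i)) ->
  invariant_measure mu (T 0%N) ->
  0 < eps ->
  exists U : forall i, 'I_(m i).+1 -> set (X i),
    (forall i, (i < k)%N ->
       is_open_cover (U i) /\
       (cover_dist (pushforward mu (tau p i : borel (X 0%N) -> borel (X i)))
                   (U i) (alpha i) < eps%:E)%E) /\
    ((\sum_(0 <= i < k)
         a i * ks_entropy mu (T 0%N)
                 (join [set j | (i <= j < k)%N]
                       (fun j => pullback (tau p j) (range (alpha j)))))%:E
      + \int[mu]_x (f x)%:E - eps%:E
     <= pressure k a (T 0%N) p (fun i => range (U i)) f (supp mu))%E.

Proof.
move=> k1 a0 a_pos htds hfac cf halpha inv eps0.
have a_ge0 i : (i < k)%N -> 0 <= a i.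
  by case: i => [_|i ik]; [exact: ltW|exact: a_pos].
have [cX cS] := htds 0%N k1.
have ctau i : (i < k)%N -> continuous (tau p i).
  elim: i => [|i IH] ik x; first exact: cvg_id.
  have [cp _ _] := hfac i ik.
  by apply: (@continuous_comp _ _ _ (tau p i) (p i)); [exact: (IH (ltnW ik))|exact: cp].
pose S : borel (X 0%N) -> borel (X 0%N) := T 0%N.
have mS : measurable_fun setT S := continuous_borel cS.
have bf : bdmeas (f : borel (X 0%N) -> R) := continuous_bdmeas cX cf.
have [cell cellP] : exists cell : nat -> X 0%N -> nat, forall j, (j < k)%N -> forall x,
    exists2 l : 'I_(m j), nat_of_ord l = cell j x & alpha j l (tau p j x).
  have /choice [c cE] : forall z : nat * X 0%N, exists c : nat, (z.1 < k)%N ->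
      exists2 l : 'I_(m z.1), nat_of_ord l = c & alpha z.1 l (tau p z.1 z.2).
    move=> [j x] /=; have [jk|_] := boolP (j < k)%N; last by exists 0%N.
    have [cov _ _] := halpha j jk.
    have [l _ ax] : (\bigcup_l alpha j l) (tau p j x) by rewrite cov.
    by exists l => _; exists l.
  by exists (fun j x => c (j, x)) => j jk x; exact: (cE (j, x)).
pose nm i : borel (X 0%N) -> _ := name k m cell i.
have mnm i : finmeas (nm i) by exact: (finmeas_name halpha ctau cellP).
have [eta eta0 mass] := weighted_mass mS inv k1 a0 a_ge0 mnm
  (r := fun i j => coarsen j) (fun i j x => @name_coarsen _ _ _ _ _ i j x) bf eps0.
(* The first bound is for the distance to the partitions; the second makes the union of the [k]
   exceptional sets have measure below [eta]. *)
pose e' := Num.min eps (eta / k.+1%:R).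
have e'0 : 0 < e' by rewrite lt_min eps0 divr_gt0.
have exU i : exists U : 'I_(m i).+1 -> set (X i), (i < k)%N ->
  [/\ is_open_cover U,
      (cover_dist (pushforward mu (tau p i : borel (X 0%N) -> borel (X i))) U (alpha i) < e'%:E)%E,
      prob mu (tau p i @^-1` U ord0) < e' &
      forall l x, U (lift ord0 l) x -> ~ U ord0 x -> alpha i l x].
  have [ik|_] := boolP (i < k)%N; last by exists (fun=> set0).
  have [U h] := partition_open_cover mu (continuous_borel (ctau i ik)) (halpha i ik) e'0.
  by exists U.
pose U i := projT1 (cid (exU i)).
have UP i := projT2 (cid (exU i)).
exists U; split.
  move=> i ik; have [oU cd _ _] := UP i ik; split=> //.
  by apply: lt_le_trans cd _; rewrite lee_fin ge_min lexx.
(* The bad set: some image of the point lies in the exceptional member of its cover, which does not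
   tell the cell. *)
pose V : set (borel (X 0%N)) := \bigcup_(j in [set j | (j < k)%N]) (tau p j @^-1` U j ord0).
have mtU j : (j < k)%N -> measurable (tau p j @^-1` U j ord0 : set (borel (X 0%N))).
  move=> jk; apply: (preimage_borel (continuous_borel (ctau j jk))).
  by apply: open_borel; have [[_ +] _ _ _] := UP j jk; exact.
have mV : measurable V by apply: bigcup_measurable => j jk; exact: mtU.
have Veta : prob mu V < eta.
  have h : prob mu V <= \sum_(j < k) prob mu (tau p j @^-1` U j ord0 : set (borel (X 0%N))).
    apply: prob_le_sum => // [j|x [j jk Ux]]; first exact: mtU.
    by exists (Ordinal jk).
  apply: (le_lt_trans h); apply: (@le_lt_trans _ _ (\sum_(j < k) eta / k.+1%:R)).
    apply: ler_sum => j _; have [_ _ /ltW le _] := UP j (ltn_ord j).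
    by apply: (le_trans le); rewrite ge_min lexx orbT.
  rewrite sumr_const card_ord -[ltLHS]mulr_natl mulrCA -[ltRHS]mulr1 ltr_pM2l//.
  by rewrite ltr_pdivrMr// mul1r ltr_nat.
have [G [M [mG G0 Gmass]]] := mass V mV Veta.
have c00 : csum a 0 = a 0%N by rewrite /csum big_ord_recl big_ord0 addr0.
have intf : (\int[mu]_x (f x)%:E = (mean mu f)%:E)%E.
  by rewrite /mean /Rintegral fineK//; exact: integrable_fin_num (bdmeas_integrable mu bf).
rewrite intf -EFinD.
have -> : \sum_(0 <= i < k) a i * ks_entropy mu (T 0%N)
      (join [set j | (i <= j < k)%N] (fun j => pullback (tau p j) (range (alpha j)))) =
    \sum_(0 <= i < k) a i * entropy_rate mu S (nm i).
  by apply: eq_bigr => i _; rewrite (ks_entropy_name halpha ctau cS inv cellP).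
apply: (pressure_ge (c := prob mu G)) => // s sH.
apply: (Lambda_ge (M := M)) => N MN.
apply: (Lambda_N_mass cS bf _ _ mG _ MN).
- by apply: closed_borel; exact: closed_supp.
- exact: prob_supp.
move=> n Mn B [B' wB <-] A mA AB sigma Asig.
(* The join element fixes one cover member for each index [j] and time [l]; off the exceptional
   member it determines the cell, so one number serves all of [A]. If the member fixed is the
   exceptional one, the claim is vacuous and [0] will do. *)
have /choice [c cE] : forall z : nat * nat, exists c : nat, (z.1 < k)%N ->
    (z.2 < threshold a n z.1)%N -> forall x, A x ->
    ~ U z.1 ord0 (tau p z.1 (iter z.2 S x)) -> cell z.1 (iter z.2 S x) = c.
  move=> [j l] /=; have [jk|_] := boolP (j < k)%N; last by exists 0%N.
  have [lt|_] := boolP (l < threshold a n j)%N; last by exists 0%N.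
  have [B'' wB'' B''E] := wB j jk.
  have [_ [_ [u _ <-] <-] B''l] := wB'' l lt.
  have Au x : A x -> U j u (tau p j (iter l S x)).
    move=> /AB /(_ j jk); rewrite -B''E => /(_ l lt).
    by rewrite -B''l.
  have [_ _ _ UK] := UP j jk.
  case: (unliftP ord0 u) Au => [l'|] -> Au; last by exists 0%N => _ _ x /Au.
  exists l' => _ _ x /Au Ux U0; apply: (cell_unique halpha cellP jk); exact: UK.
pose lev := level k (threshold a n).
pose b l : {ffun 'I_k -> 'I_(\sum_(j < k) m j).+1} :=
  [ffun j : 'I_k => if (j < lev l)%N then ord0 else inord (c (nat_of_ord j, l))].
apply: le_trans (Gmass n Mn b A sigma mA _ _) _.
(* Off [V] at time [l], the coordinates from the level upwards are as predicted, since [level_lt]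
   puts [l] below their thresholds; the others are blank on both sides. *)
- move=> x Ax l lL; apply: contra_notP => nV; apply/ffunP => j; rewrite !ffunE.
  case: ltnP => // jl; congr inord; apply: (cE (nat_of_ord j, l)) => //=.
    apply: (level_lt (threshold_nd a0 a_ge0 n)) => //.
  by move=> U0; apply: nV; exists (nat_of_ord j) => //=.
- by move=> x Ax; rewrite /threshold c00; exact: Asig.
rewrite ler_expR lerD2r ler_wpM2r// lerN2; exact: ltW.
Qed.
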